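(* Let $F_t:\mathbb H\to\mathbb R$ be an $A$-admissible nonlinearity, $h$-regularizing with $h>dr$, let $G_t=F_t\circ\phi_t^A$ and $G_t^k(u)=F_t^k(\phi_t^Au)$ with $F_t^k(u)=F_t(u^k)$. For every $k\ge1$ let $\widetilde u^k:\mathbb R\times\mathbb R\to V_k$ be a smooth map satisfying $$(\partial_s+i\partial_t)\widetilde u^k+\varphi_k(s)\nabla G^k_t(\widetilde u^k)=0,\qquad \widetilde u^k(s,t+T)=\phi^A_{-T}\widetilde u^k(s,t),\qquad \lim_{s\to\pm\infty}\widetilde u^k(s,t)=0,$$ let $\widetilde u:\mathbb R\times\mathbb R\to\mathbb H$ be the $C^{\lfloor h/d\rfloor-1}_{\mathrm{loc}}$-limit of a subsequence of $(\widetilde u^k)_k$, and let $u_1(t)=\lim_{n\to\infty}\widetilde u(s_n^+,t)$ (limit in the $C^{\lfloor h/d\rfloor-1}$-sense in $t$, for some sequence $s_n^+\to+\infty$) be a $\phi_T^A$-periodic orbit of $G_t$, i.e. $\dot u_1=J\nabla G_t(u_1)$, $u_1(t+T)=\phi^A_{-T}u_1(t)$. Then the Floer curve $\widetilde u$, and in particular the $T$-periodic solution $u(t)=\phi_t^Au_1(t)$, is of regularity $h-d(r-1)-\tfrac12$, i.e. $\widetilde u$ is a map $$\widetilde u:\mathbb R\times\mathbb R\to\mathbb H_{h-d(r-1)-1/2}\subset\mathbb H,$$ and $u(t)\in\mathbb H_{h-d(r-1)-1/2}$ for all $t\in\mathbb R$.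
   Context: Setting. $\mathbb H$ is a separable real Hilbert space with symplectic form $\omega$ and a complete orthonormal Darboux basis $e_n^\pm$, $n\in\mathbb Z\setminus\{0\}$: $\omega(e_i^+,e_j^-)=\delta_{ij}$, $Je_n^\pm=\mp e_n^\mp$, $\omega=\langle\cdot,J\cdot\rangle$. With $z_n=2^{-1/2}(e_n^++ie_n^-)$, $\mathbb H$ is identified with the complex Hilbert space with orthonormal basis $(z_n)$, with $J=i$; write $u=\sum_n\hat u(n)z_n$. Put $V_k=\mathrm{Span}_{\mathbb C}\{z_n:0<|n|\le k\}\subset\mathbb H$ and $u^k=\sum_{|n|\le k}\hat u(n)z_n$, the projection of $u$ to $V_k$. Hilbert scale: $|u|_h^2=\sum_n|n|^{2h}|\hat u(n)|^2$, and for $h\in\mathbb R$, $\mathbb H_h$ is the space of (formal) series with $|u|_h<\infty$; $\mathbb H_0=\mathbb H$. Admissible $A$: a densely defined self-adjoint operator with $Ae_n^\pm=\lambda_ne_n^\pm$, $\lambda_n=an^d$, $d\ge1$ an integer (the order of $A$), $a=(2\pi/X)^d$, $X>0$ the space period. Free flow: $\phi_t^A=e^{tJA}$, i.e. $\phi_t^Az_n=e^{itan^d}z_n$. The pair $(T,X)\in\mathbb R_{>0}^2$ is admissible if $aT/2\pi$ is Diophantine, i.e. has finite irrationality measure $r$; the irrationality measure of an irrational $\sigma$ is the infimum of all $\rho$ for which there is $c>0$ with $|\sigma-p/q|>c\,q^{-\rho}$ for all $p/q\in\mathbb Q$. Nonlinearities: time-dependent functions $F_t:\mathbb H\to\mathbb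 R$, always assumed smooth in $t$. $F_t$ is $h$-regularizing if it extends to a smooth map $\mathbb H_{-h}\to\mathbb R$. $F_t$ is $A$-admissible if $A$ is admissible and: (1) $F_{t+T}=F_t$ with $(T,X)$ admissible; (2) $F_t$ is $h$-regularizing with $h>dr$, $r$ the irrationality measure of $aT/2\pi$; (3) the extended map $F_t:\mathbb H_{-h}\to\mathbb R$ has bounded $C^\alpha$-norms for all $\alpha\in\mathbb N$ (uniformly in $t$); (4) for every $k\in\mathbb N$ there is $R_k>0$ such that $F_t(u)=0$ whenever $|u^k|>R_k$. Cut-off functions: $\varphi\in C^\infty(\mathbb R)$ with $\varphi(s)=0$ for $s\le-1$, $\varphi(s)=1$ for $s\ge0$, $0\le\varphi'\le2$. For $k\ge1$, $\varphi_k\in C^\infty(\mathbb R)$ with $\varphi_k(s)=0$ for $s\le-1$ and for $s\ge2k+1$, $\varphi_k(s)=1$ for $s\in[0,2k]$, $0\le\varphi_k'(s)\le2$ for $s<0$, $-2\le\varphi_k'(s)\le0$ for $s>0$, and $\varphi_k(s)\to\varphi(s)$ as $k\to\infty$ for every $s\in\mathbb R$. The limit $\widetilde u$ satisfies $(\partial_s+i\partial_t)\widetilde u+\varphi(s)\nabla G_t(\widetilde u)=0$ and $\widetilde u(s,t+T)=\phi^A_{-T}\widetilde u(s,t)$. *)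

(* Defs.v *)
From HB Require Import structures.
From mathcomp Require Import all_boot all_order all_algebra.
From mathcomp Require Import finmap.
From mathcomp Require Import all_classical all_reals all_analysis.
From mathcomp Require Import complex.
From mathcomp Require Import ring lra.

Set Implicit Arguments.
Unset Strict Implicit.
Unset Printing Implicit Defensive.

Import Order.TTheory GRing.Theory Num.Theory.
Import numFieldNormedType.Exports.

Local Open Scope classical_set_scope.
Local Open Scope ring_scope.

Definition mode := {n : int | n != 0}.

(* [Rcomplex R] is [R[i]] seen as a real vector space with the R-valued
   modulus as norm. The Hilbert space is the sequence model given by the
   complex orthonormal basis [z_n], in which [J] is the multiplication by [i];
   a formal series [\sum_n u n z_n] is represented by its coefficients. *)
Definition fseries (R : realType) := mode -> Rcomplex R.

Section Scale.
Variable R : realType.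
Implicit Types (h : R) (u v : fseries R).

Definition weight h (n : mode) : R := (absz (val n))%:R `^ (2 * h).

Definition sqnorm h u : \bar R :=
  \esum_(n in [set: mode]) (weight h n * `|u n| ^+ 2)%:E.

(* The (formal) series with [|u|_h] finite; [Hilb h] below is the space itself,
   as a real normed space, and [Hilb 0] is the phase space. *)
Definition scale h : {pred fseries R} := fun u => `[< (sqnorm h u < +oo)%E >].

Let q h (X : {fset mode}) u : R := \sum_(n <- X) weight h n * `|u n| ^+ 2.

Let term_ge0 h u n : 0 <= weight h n * `|u n| ^+ 2.
Proof. by rewrite mulr_ge0 ?powR_ge0 ?sqr_ge0. Qed.

Lemma sqnorm_ge0 h u : (0 <= sqnorm h u)%E.
Proof. by apply: esum_ge0 => n _; rewrite lee_fin. Qed.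

Let sqnorm_le h u (M : R) : (forall X, q h X u <= M) -> (sqnorm h u <= M%:E)%E.
Proof.
move=> H; apply: ge_ereal_sup => _ [A [finA _] <-].
by rewrite fsbig_finite//= sumEFin lee_fin; apply: H.
Qed.

Let q_le h u X : u \in scale h -> q h X u <= fine (sqnorm h u).
Proof.
move=> /asboolP ufin.
have sfin : (sqnorm h u \is a fin_num)%E by rewrite ge0_fin_numE// sqnorm_ge0.
rewrite -lee_fin (fineK sfin).
apply: ereal_sup_ubound; exists [set` X]; first by split=> //; exact: finite_fset.
by rewrite fsbig_finite//= sumEFin set_fsetK.
Qed.

Let scale_le h u (M : R) :
  (forall X, q h X u <= M) -> u \in scale h /\ fine (sqnorm h u) <= M.
Proof.
move=> /sqnorm_le H; have fin : u \in scale h.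
  by apply/asboolP; rewrite (le_lt_trans H)// ltry.
split=> //; move/asboolP: fin => fin.
by rewrite -lee_fin fineK// ge0_fin_numE// sqnorm_ge0.
Qed.


Lemma scale0 h : 0 \in scale h.
Proof.
apply: (proj1 (@scale_le h 0 0 _)) => X.
by rewrite /q big1// => n _; rewrite [X in `|X|](_ : _ = 0)// normr0 expr0n mulr0.
Qed.

Let qZ h X (a : R) u : q h X (a *: u) = a ^+ 2 * q h X u.
Proof.
rewrite /q mulr_sumr; apply: eq_bigr => n _; rewrite [RHS]mulrCA; congr (_ * _).
have -> : (a *: u) n = a *: u n by [].
have -> : `|a *: u n| = `|a| * `|u n|.
  rewrite -(sqrtr_sqr a); case: (u n) => x y.
  rewrite [LHS]/(Num.sqrt ((a * x) ^+ 2 + (a * y) ^+ 2)).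
  rewrite [X in _ = _ * X]/(Num.sqrt (x ^+ 2 + y ^+ 2)).
  by rewrite -sqrtrM ?sqr_ge0//; congr (Num.sqrt _); ring.
by rewrite exprMn real_normK// num_real.
Qed.

Let q_ge0 h X u : 0 <= q h X u.
Proof. by apply: sumr_ge0 => n _. Qed.

Let qD h X u v (t : R) : 0 < t ->
  q h X (u + v) <= (1 + t) * q h X u + (1 + t^-1) * q h X v.
Proof.
move=> t0; rewrite /q !mulr_sumr -big_split/=; apply: ler_sum => n _.
have -> : (u + v) n = u n + v n by [].
rewrite (mulrCA _ (weight h n)) (mulrCA _ (weight h n)) -mulrDr.
apply: ler_wpM2l; first exact: powR_ge0.
have := ler_normD (u n) (v n).
move: (normr_ge0 (u n + v n)) (normr_ge0 (u n)) (normr_ge0 (v n)).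
set a := `|u n + v n|; set b := `|u n|; set c := `|v n| => a0 b0 c0 abc.
have : a ^+ 2 <= (b + c) ^+ 2 by rewrite ler_sqr ?nnegrE ?addr_ge0.
move=> /le_trans; apply.
rewrite -subr_ge0.
have -> : (1 + t) * b ^+ 2 + (1 + t^-1) * c ^+ 2 - (b + c) ^+ 2
   = t * (b - c / t) ^+ 2 by field; rewrite gt_eqF.
by rewrite mulr_ge0 ?sqr_ge0// ltW.
Qed.

Definition snorm h u : R := Num.sqrt (fine (sqnorm h u)).

Let sq_ge0 h u : 0 <= fine (sqnorm h u).
Proof. by rewrite fine_ge0// sqnorm_ge0. Qed.

Let snorm_sq h u : snorm h u ^+ 2 = fine (sqnorm h u).
Proof. by rewrite sqr_sqrtr. Qed.

Let q1 h n u : q h [fset n]%fset u = weight h n * `|u n| ^+ 2.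
Proof. by rewrite /q big_seq_fset1. Qed.

Lemma snorm_eq0 h u : u \in scale h -> snorm h u = 0 -> u = 0.
Proof.
move=> us u0; apply/funext => n.
have : fine (sqnorm h u) = 0 by rewrite -snorm_sq u0 expr0n.
move=> e; have := q_le [fset n]%fset us; rewrite e q1.
have n0 : 0 < weight h n.
  by apply: powR_gt0; rewrite ltr0n absz_gt0; exact: valP n.
rewrite pmulr_rle0// => H; apply/eqP; rewrite -normr_eq0 -sqrf_eq0.
by rewrite eq_le H sqr_ge0.
Qed.

Lemma snormZ_le h (a : R) u : u \in scale h ->
  a *: u \in scale h /\ snorm h (a *: u) <= `|a| * snorm h u.
Proof.
move=> us; have [|H1 H2] := @scale_le h (a *: u) (a ^+ 2 * fine (sqnorm h u)).
  by move=> X; rewrite qZ ler_wpM2l ?sqr_ge0// q_le.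
split=> //; rewrite -sqrtr_sqr -sqrtrM ?sqr_ge0//.
by rewrite ler_wsqrtr.
Qed.

Lemma snormZ h (a : R) u : u \in scale h -> snorm h (a *: u) = `|a| * snorm h u.
Proof.
move=> us; have [aus le1] := snormZ_le a us.
apply/eqP; rewrite eq_le le1/=.
have [->|a0] := eqVneq a 0; first by rewrite normr0 mul0r sqrtr_ge0.
have [_] := snormZ_le a^-1 aus; rewrite scalerA mulVf// scale1r => le2.
by rewrite -ler_pdivlMl ?normr_gt0// -normfV.
Qed.

Lemma snormD h u v : u \in scale h -> v \in scale h ->
  u + v \in scale h /\ snorm h (u + v) <= snorm h u + snorm h v.
Proof.
move=> us vs.
have [u0|u0] := eqVneq (snorm h u) 0.
  by rewrite (snorm_eq0 us u0) add0r; split=> //; rewrite lerDr sqrtr_ge0.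
have [v0|v0] := eqVneq (snorm h v) 0.
  by rewrite (snorm_eq0 vs v0) addr0; split=> //; rewrite lerDl sqrtr_ge0.
have {}u0 : 0 < snorm h u by rewrite lt_neqAle eq_sym u0 sqrtr_ge0.
have {}v0 : 0 < snorm h v by rewrite lt_neqAle eq_sym v0 sqrtr_ge0.
have [|H1 H2] := @scale_le h (u + v) ((snorm h u + snorm h v) ^+ 2).
  move=> X; apply: (le_trans (@qD h X u v (snorm h v / snorm h u) _)).
    by rewrite divr_gt0.
  have -> : (snorm h u + snorm h v) ^+ 2 =
     (1 + snorm h v / snorm h u) * snorm h u ^+ 2 +
     (1 + (snorm h v / snorm h u)^-1) * snorm h v ^+ 2.
    by field; rewrite !gt_eqF.
  rewrite !snorm_sq; apply: lerD; apply: ler_wpM2l; rewrite ?q_le//.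
    by rewrite addr_ge0// ltW// divr_gt0.
  by rewrite addr_ge0// invr_ge0 ltW// divr_gt0.
split=> //; rewrite -(ger0_norm (addr_ge0 (ltW u0) (ltW v0))) -sqrtr_sqr.
by rewrite ler_wsqrtr.
Qed.

Lemma scale_diag h (m : mode -> Rcomplex R) u :
  (forall n, `|m n| <= 1) -> u \in scale h -> (fun n => m n * u n) \in scale h.
Proof.
move=> m1 us; apply: (proj1 (@scale_le h _ (fine (sqnorm h u)) _)) => X.
apply: le_trans (q_le X us); apply: ler_sum => n _.
apply: ler_wpM2l; first exact: powR_ge0.
have -> : `|(m n * u n : Rcomplex R)| = `|m n| * `|u n| by exact: Normc.normcM.
by rewrite exprMn ler_piMl ?sqr_ge0// expr_le1.
Qed.

Lemma scale_submod h : submod_closed (scale h).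
Proof.
split; first exact: scale0.
move=> a u v us vs; exact: (snormD (snormZ_le a us).1 vs).1.
Qed.

HB.instance Definition _ h :=
  GRing.isSubmodClosed.Build R (fseries R) (scale h) (scale_submod h).

Record Hilb h := MkHilb { coef : fseries R ; _ : coef \in scale h }.

HB.instance Definition _ h := [isSub for @coef h].
HB.instance Definition _ h := [Choice of Hilb h by <:].
HB.instance Definition _ h := [SubChoice_isSubLmodule of Hilb h by <:].

Definition hnorm h (u : Hilb h) : R := snorm h (coef u).

Lemma hnormD h (u v : Hilb h) : hnorm (u + v) <= hnorm u + hnorm v.
Proof. exact: (snormD (valP u) (valP v)).2. Qed.

Lemma hnormZ h (a : R) (u : Hilb h) : hnorm (a *: u) = `|a| * hnorm u.
Proof. exact: (snormZ a (valP u)). Qed.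

Lemma hnorm_eq0 h (u : Hilb h) : hnorm u = 0 -> u = 0.
Proof. by move=> /(snorm_eq0 (valP u)) u0; apply: val_inj. Qed.

HB.instance Definition _ h :=
  Lmodule_isNormed.Build R (Hilb h) (@hnormD h) (@hnormZ h) (@hnorm_eq0 h).

End Scale.

Section Operators.
Variable R : realType.
Implicit Types h : R.

Definition diag h (m : mode -> Rcomplex R) (m1 : forall n, `|m n| <= 1)
  (u : Hilb h) : Hilb h := MkHilb (scale_diag m1 (valP u)).

Definition expi (x : R) : Rcomplex R := (cos x +i* sin x)%C.

Lemma norm_expi x : `|expi x| <= 1.
Proof.
by rewrite [X in X <= _](_ : _ = Num.sqrt (cos x ^+ 2 + sin x ^+ 2))// cos2Dsin2 sqrtr1.
Qed.

Lemma norm_imaginary (n : mode) : `|(0 +i* 1 : R[i])%C : Rcomplex R| <= 1.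
Proof.
rewrite [X in X <= _](_ : _ = Num.sqrt (0 ^+ 2 + 1 ^+ 2))//.
by rewrite expr0n expr1n add0r sqrtr1.
Qed.

Definition low (k : nat) (n : mode) : Rcomplex R :=
  (((absz (val n) <= k)%N : nat)%:R : R)%:C%C.

Lemma norm_low k n : `|low k n| <= 1.
Proof.
rewrite /low; set b := (X in X%:R).
rewrite [X in X <= _](_ : _ = Num.sqrt (b%:R ^+ 2 + 0 ^+ 2))//.
by rewrite [0 ^+ 2]expr0n addr0 sqrtr_sqr normr_nat /b; case: (_ <= _)%N.
Qed.

Definition Jop h : Hilb h -> Hilb h := diag norm_imaginary.

(* [projV k u] is the projection [u^k] of [u] to [V_k]. *)
Definition projV h (k : nat) : Hilb h -> Hilb h := diag (norm_low k).

Definition Vk h (k : nat) : set (Hilb h) :=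
  [set u | forall n, (k < absz (val n))%N -> coef u n = 0].

Definition eigA (X : R) (d : nat) (n : mode) : R :=
  (2 * pi / X) ^+ d * (val n)%:~R ^+ d.

Definition flow (X : R) (d : nat) h (t : R) : Hilb h -> Hilb h :=
  diag (fun n => norm_expi (t * eigA X d n)).

Definition posmode (j : nat) : mode := exist _ (Posz j.+1) isT.
Definition negmode (j : nat) : mode := exist _ (Negz j) isT.

(* The real inner product [Re (\sum_n u n * conj (v n))], summed over
   [0 < |n| <= k] with [k] tending to infinity ([Negz j] is [- j.+1]). *)
Definition inner (u v : Hilb (0 : R)) : R :=
  let term n : R := complex.Re (coef u n * conjc (coef v n)) in
  limn (fun k => \sum_(0 <= j < k) (term (posmode j) + term (negmode j))).

Definition is_gradient (f : Hilb (0 : R) -> R) (u g : Hilb (0 : R)) :=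
  differentiable (f : _ -> R^o) u /\
  forall v, 'd (f : _ -> R^o) u v = inner g v.

End Operators.

Section Smooth.
Variables (R : realType) (V W : normedModType R).

(* [D x [:: v1; ...; vk]] is the k-th Frechet derivative of [f] at [x], a
   bounded k-linear map, for [k <= N]; the derivative of order [k.+1] is the
   Frechet derivative, for the operator norm, of the derivative of order [k],
   with the new direction put first. The derivative of order [N] is continuous. *)
Record is_jet (N : nat) (f : V -> W) (D : V -> seq V -> W) : Prop := {
  jet0 : forall x, D x [::] = f x;
  jet_multilinear : forall x s1 s2 (a : R) v w, (size s1 + size s2 < N)%N ->
    D x (s1 ++ (a *: v + w) :: s2) =
    a *: D x (s1 ++ v :: s2) + D x (s1 ++ w :: s2);
  jet_bounded : forall x k, (k <= N)%N -> exists C : R,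
    forall s, size s = k -> `|D x s| <= C * \prod_(v <- s) `|v|;
  jet_derivative : forall x k (e : R), (k < N)%N -> 0 < e ->
    \forall y \near x, forall s, size s = k ->
    `|D y s - D x s - D x ((y - x) :: s)| <= e * `|y - x| * \prod_(v <- s) `|v|;
  jet_continuous : forall x (e : R), 0 < e ->
    \forall y \near x, forall s, size s = N ->
    `|D y s - D x s| <= e * \prod_(v <- s) `|v| }.

Definition class_C (N : nat) (f : V -> W) := exists D, is_jet N f D.

Definition smooth (f : V -> W) := forall N, class_C N f.

Definition C_norm_le (N : nat) (f : V -> W) (C : R) :=
  exists2 D, is_jet N f D &
    forall x s, (size s <= N)%N -> `|D x s| <= C * \prod_(v <- s) `|v|.

End Smooth.

Section Diophantine.
Variable R : realType.

Definition irr_exponents (x : R) : set R :=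
  [set rho | exists2 c : R, 0 < c & forall (p : int) (q : nat), (0 < q)%N ->
     c * q%:R `^ (- rho) < `|x - p%:~R / q%:R| ].

Definition diophantine (x : R) := irrational x /\ irr_exponents x !=set0.

(* Meaningful only if [diophantine x]: otherwise the measure is infinite. *)
Definition irr_measure (x : R) : R := inf (irr_exponents x).

End Diophantine.

Section Nonlinearity.
Variable R : realType.
Local Notation H := (Hilb (0 : R)).
Implicit Types (X T h : R) (d : nat) (F : R -> H -> R).

(* [a T / 2 pi] with [a = (2 pi / X) ^ d]. *)
Definition freq X T d : R := (2 * pi / X) ^+ d * T / (2 * pi).

(* [coef w = coef u] is the inclusion of [Hilb 0] in [Hilb (- h)]. *)
Definition extends h F (Fe : R -> Hilb (- h) -> R) :=
  forall t (u : H) (w : Hilb (- h)), coef w = coef u -> Fe t w = F t u.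

(* Smoothness in [u] and in [t] is joint, on [R * Hilb (- h)]. *)
Definition regularizing h F (Fe : R -> Hilb (- h) -> R) :=
  extends F Fe /\
  smooth (fun p : (R^o * Hilb (- h))%type => Fe p.1 p.2 : R^o).

Record A_admissible X T h d F : Prop := {
  adm_order : (0 < d)%N;
  adm_X : 0 < X;
  adm_T : 0 < T;
  adm_diophantine : diophantine (freq X T d);
  adm_periodic : forall t u, F (t + T) u = F t u;
  adm_h : d%:R * irr_measure (freq X T d) < h;
  adm_extension : exists2 Fe : R -> Hilb (- h) -> R, regularizing F Fe &
    forall N, exists C : R, forall t, C_norm_le N (Fe t : _ -> R^o) C;
  adm_support : forall k : nat, exists2 Rk : R, 0 < Rk &
    forall t u, Rk < `|projV k u| -> F t u = 0 }.

Record cutoff (phi : R -> R) : Prop := {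
  cutoff_smooth : smooth (phi : R^o -> R^o);
  cutoff_left : forall s, s <= -1 -> phi s = 0;
  cutoff_right : forall s, 0 <= s -> phi s = 1;
  cutoff_slope : forall s, 0 <= derive1 phi s <= 2 }.

Record cutoff_k (k : nat) (phi : R -> R) : Prop := {
  cutoff_k_smooth : smooth (phi : R^o -> R^o);
  cutoff_k_left : forall s, s <= -1 -> phi s = 0;
  cutoff_k_right : forall s, (2 * k + 1)%N%:R <= s -> phi s = 0;
  cutoff_k_mid : forall s, 0 <= s <= (2 * k)%N%:R -> phi s = 1;
  cutoff_k_slope_left : forall s, s < 0 -> 0 <= derive1 phi s <= 2;
  cutoff_k_slope_right : forall s, 0 < s -> -2 <= derive1 phi s <= 0 }.

Definition Gt X d F (t : R) : H -> R := fun u => F t (flow X d t u).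

Definition Ftrunc (k : nat) F : R -> H -> R := fun t u => F t (projV k u).

Local Notation plane := (R^o * R^o)%type.

Definition dels (u : plane -> H) : plane -> H := 'D_((1, 0) : plane) u.
Definition delt (u : plane -> H) : plane -> H := 'D_((0, 1) : plane) u.

(* The limits as [s -> +-oo] are uniform in [t], the meaning of the asymptotic
   condition for Floer curves (convergence of the loops [u (s, .)]). *)
Record floer_curve X T d F (k : nat) (phi : R -> R) (u : plane -> H) : Prop := {
  floer_V : forall p, Vk k (u p);
  floer_smooth : smooth u;
  floer_eq : forall s t : R, exists2 g : H,
    is_gradient (Gt X d (Ftrunc k F) t) (u (s, t)) g &
    dels u (s, t) + Jop (delt u (s, t)) + phi s *: g = 0;
  floer_twist : forall s t : R, u (s, t + T) = flow X d (- T) (u (s, t));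
  floer_pinfty : {uniform [set: R], (fun s t : R => u (s, t)) @ +oo --> (fun=> 0 : H)};
  floer_ninfty : {uniform [set: R], (fun s t : R => u (s, t)) @ -oo --> (fun=> 0 : H)} }.

Record periodic_orbit X T d F (u : R -> H) : Prop := {
  orbit_derivable : forall t, derivable (u : R^o -> H) t 1;
  orbit_eq : forall t, exists2 g : H,
    is_gradient (Gt X d F t) (u t) g & derive1 u t = Jop g;
  orbit_twist : forall t, u (t + T) = flow X d (- T) (u t) }.

Definition C_loc_limit (N : nat) (w : nat -> plane -> H) (u : plane -> H) :=
  class_C N u /\
  forall i j, (i + j <= N)%N ->
    {family compact, (fun m => iter i dels (iter j delt (w m))) @ \oo -->
                     iter i dels (iter j delt u)}.

Definition C_limit (N : nat) (w : nat -> R -> H) (u : R -> H) :=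
  class_C N (u : R^o -> H) /\
  forall j, (j <= N)%N ->
    {family compact, (fun m => derive1n j (w m)) @ \oo --> derive1n j u}.

End Nonlinearity.

(* Main.v *)
(** Fourier coefficients [w_n] of a truncated Floer curve satisfy
    [(d_s + i d_t) w_n = - phi_k g_n] and are twisted-periodic in [t], and the gradient
    [g] is bounded in the norm of order [h] by duality, uniformly in [k].  Put
    [kappa = 2 pi / T].  Because of the Diophantine condition the decay rate [mu_n] for
    which [exp (- mu_n z) w_n(z)], [z = s + i t], is [T]-periodic in [t] has distance at
    least [c |n| ^ (- d (rho - 1))] from [0] and [kappa], for [rho] slightly larger than
    the irrationality measure [r].

    Fix a point, taken to be the origin, and weights [a_n = |n| ^ sigma] with
    [sigma = h - d (r - 1) - 1/2].  The function
      [Psi(z) = \sum_n a_n ^ 2 conj(w_n(0)) exp (- mu_n z) w_n(z)]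
    is [T]-periodic in [t] and [Psi(0)] is the squared norm [S] to be bounded.
    Cauchy's formula on the cylinder, with the kernel [K = 1 / (1 - exp (- kappa z))], bounds
    [T Psi(0)] by the integral of [|K (d_s + i d_t) Psi|]; bounding the integrand at each
    point by Cauchy-Schwarz in [n] uses only the pointwise bound on
    [\sum_n |n| ^ (2 h) |g_n| ^ 2] and the integrability in [s] of
    [sup_n |n| ^ (sigma - h) exp (- c |n| ^ (- d (rho - 1)) |s|)], which the [1/2] in
    [sigma] provides.  This gives [S <= C sqrt S] with [C] independent of [k] and of the
    point, and the bound passes to the pointwise limits [k -> oo] and [s_n -> oo]. *)
Require Import Defs.
From mathcomp Require Import all_boot all_order all_algebra.
From mathcomp Require Import finmap.
From mathcomp Require Import all_classical all_reals all_analysis.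
From mathcomp Require Import complex.
From mathcomp Require Import ring lra.
Set Implicit Arguments.
Unset Strict Implicit.
Unset Printing Implicit Defensive.
Import Order.TTheory GRing.Theory Num.Theory.
Import numFieldNormedType.Exports.
Local Open Scope classical_set_scope.
Local Open Scope ring_scope.

(** * Integrals of continuous functions over a symmetric interval *)

Section Integral.
Variables (R : realType) (L : R).
Hypothesis L0 : 0 < L.
Implicit Types f g : R -> R.
Local Notation mu := (@lebesgue_measure R).

Definition integ f : R := \int[mu]_(t in `[- L, L]) f t.

Let NL : - L < L. Proof. by rewrite gtrN. Qed.

Lemma continuous_integrable f : continuous f -> mu.-integrable `[- L, L] (EFin \o f).
Proof.
move=> cf; apply: continuous_compact_integrable; first exact: segment_compact.
exact: continuous_subspaceT.
Qed.

Lemma integB f g : continuous f -> continuous g ->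
  integ (fun t => f t - g t) = integ f - integ g.
Proof. by move=> cf cg; rewrite /integ RintegralB//; exact: continuous_integrable. Qed.

Lemma integD f g : continuous f -> continuous g ->
  integ (fun t => f t + g t) = integ f + integ g.
Proof. by move=> cf cg; rewrite /integ RintegralD//; exact: continuous_integrable. Qed.

Lemma integZ (c : R) f : continuous f -> integ (fun t => c * f t) = c * integ f.
Proof. by move=> cf; rewrite /integ RintegralZl//; exact: continuous_integrable. Qed.

Lemma integ_cst (c : R) : integ (fun=> c) = c * (2 * L).
Proof.
rewrite /integ Rintegral_cst//; congr (_ * _).
have := @lebesgue_measure_itv R `[- L, L]; rewrite /= lte_fin NL -EFinD => ->.
by rewrite /=; ring.
Qed.

Lemma le_integ f g : continuous f -> continuous g ->
  (forall t, - L <= t <= L -> f t <= g t) -> integ f <= integ g.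
Proof.
move=> cf cg fg; apply: le_Rintegral; [by []|exact: continuous_integrable|exact: continuous_integrable|].
by move=> x; rewrite /= in_itv/=; exact: fg.
Qed.

Lemma integ_norm_le f g : continuous f -> continuous g ->
  (forall t, - L <= t <= L -> `|f t| <= g t) -> `|integ f| <= integ g.
Proof.
move=> cf cg fg; rewrite ler_norml; apply/andP; split.
  rewrite -[X in X <= _]mulN1r -integZ//; apply: le_integ => //.
    by move=> t; apply: cvgM; [exact: cvg_cst|exact: cg].
  by move=> t /fg; rewrite ler_norml mulN1r => /andP[].
by apply: le_integ => // t /fg; rewrite ler_norml => /andP[].
Qed.

Lemma integ_derive f (df : R -> R) : continuous df ->
  (forall t, is_derive (t : R^o) 1 (f : R^o -> R^o) (df t)) -> integ df = f L - f (- L).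
Proof.
move=> cdf fdf; have cf : continuous f.
  move=> t; apply: differentiable_continuous; apply/derivable1_diffP.
  by case: (fdf t).
rewrite /integ /Rintegral (@continuous_FTC2 _ df f)//.
- exact: continuous_subspaceT.
- split; first by move=> t _; case: (fdf t).
    by apply: cvg_at_right_filter; exact: cf.
  by apply: cvg_at_left_filter; exact: cf.
- by move=> t _; rewrite derive1E; case: (fdf t).
Qed.

End Integral.

(** * Calculus of [C^1] functions of two real variables *)

Section C1.
Variable R : realType.
Implicit Types (P : set R) (f fs ft g gs gt : R -> R -> R).

Definition cont2 f (s t : R) :=
  {for ((s, t) : R^o * R^o), continuous (fun p : R^o * R^o => f p.1 p.2 : R^o)}.

(** The domain is cut only in [s], since the kernel used later is smooth off the line [s = 0]. The
    partial derivatives are arguments, so that each closure lemma yields explicit formulas for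
    them. *)
Record C1 P f fs ft : Prop := {
  C1_s : forall s t, P s -> is_derive (s : R^o) 1 (f ^~ t : R^o -> R^o) (fs s t);
  C1_t : forall s t, P s -> is_derive (t : R^o) 1 (f s : R^o -> R^o) (ft s t);
  C1_cont : forall s t, P s -> cont2 f s t;
  C1_conts : forall s t, P s -> cont2 fs s t;
  C1_contt : forall s t, P s -> cont2 ft s t }.

Lemma continuous_pair (V : topologicalType) (f g : V -> R^o) x :
  {for x, continuous f} -> {for x, continuous g} ->
  {for x, continuous (fun x => (f x, g x) : R^o * R^o)}.
Proof.
move=> cf cg.
exact: (@cvg_pair _ _ _ (nbhs x) (nbhs (f x)) (nbhs (g x)) _ _ _ f g cf cg).
Qed.

Lemma cont2_slice f s t : cont2 f s t -> {for t, continuous (f s : R^o -> R^o)}.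
Proof.
move=> cf; apply: (@continuous_comp _ _ _ (fun t : R^o => (s, t) : R^o * R^o)
  (fun p : R^o * R^o => f p.1 p.2 : R^o)).
  by apply: continuous_pair; [exact: cst_continuous|exact: cvg_id].
exact: cf.
Qed.

Lemma cont2_cst (c : R) s t : cont2 (fun _ _ => c) s t.
Proof. exact: cst_continuous. Qed.

Lemma cont2D f g s t : cont2 f s t -> cont2 g s t ->
  cont2 (fun s t => f s t + g s t) s t.
Proof. by move=> cf cg; apply: continuousD. Qed.

Lemma cont2N f s t : cont2 f s t -> cont2 (fun s t => - f s t) s t.
Proof. by move=> cf; apply: continuousN. Qed.

Lemma cont2B f g s t : cont2 f s t -> cont2 g s t ->
  cont2 (fun s t => f s t - g s t) s t.
Proof. by move=> cf cg; apply: continuousB. Qed.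

Lemma cont2M f g s t : cont2 f s t -> cont2 g s t ->
  cont2 (fun s t => f s t * g s t) s t.
Proof. by move=> cf cg; apply: continuousM. Qed.

Lemma cont2V f s t : f s t != 0 -> cont2 f s t -> cont2 (fun s t => (f s t)^-1) s t.
Proof. by move=> f0 cf; apply: continuousV. Qed.

Lemma cont2_fst (f : R -> R) s t : {for s, continuous (f : R^o -> R^o)} ->
  cont2 (fun s _ => f s) s t.
Proof.
move=> cf; apply: (@continuous_comp _ _ _ (fst : R^o * R^o -> R^o) (f : R^o -> R^o)).
  exact: cvg_fst.
exact: cf.
Qed.

Lemma cont2_snd (f : R -> R) s t : {for t, continuous (f : R^o -> R^o)} ->
  cont2 (fun _ t => f t) s t.
Proof.
move=> cf; apply: (@continuous_comp _ _ _ (snd : R^o * R^o -> R^o) (f : R^o -> R^o)).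
  exact: cvg_snd.
exact: cf.
Qed.

Lemma cont2_rect_bounded f (a b c d : R) :
  (forall s t, a <= s <= b -> c <= t <= d -> cont2 f s t) ->
  exists2 M : R, 0 < M & forall s t, a <= s <= b -> c <= t <= d -> `|f s t| <= M.
Proof.
move=> cf; pose Q : set (R^o * R^o) := `[a, b]%classic `*` `[c, d]%classic.
have cQ : compact Q by apply: compact_setX; exact: segment_compact.
have ctf : {within Q, continuous (fun p : R^o * R^o => f p.1 p.2 : R^o)}.
  apply: continuous_in_subspaceT => -[s t] /set_mem/= [].
  by rewrite /= !in_itv/= => sab tcd; exact: cf.
have /compact_bounded[M [_ HM]] := continuous_compact ctf cQ.
exists (`|M| + 1); first by rewrite ltr_pwDr.
move=> s t sab tcd; apply: (HM (`|M| + 1)).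
  by rewrite (le_lt_trans (ler_norm _))// ltrDl.
by exists (s, t) => //=; split; rewrite /= in_itv.
Qed.

Lemma C1D P f fs ft g gs gt : C1 P f fs ft -> C1 P g gs gt ->
  C1 P (fun s t => f s t + g s t) (fun s t => fs s t + gs s t)
    (fun s t => ft s t + gt s t).
Proof.
move=> [f1 f2 f3 f4 f5] [g1 g2 g3 g4 g5]; split=> s t Ps.
- by have := is_deriveD (f1 s t Ps) (g1 s t Ps).
- by have := is_deriveD (f2 s t Ps) (g2 s t Ps).
- by apply: cont2D; auto.
- by apply: cont2D; auto.
- by apply: cont2D; auto.
Qed.

Lemma C1N P f fs ft : C1 P f fs ft ->
  C1 P (fun s t => - f s t) (fun s t => - fs s t) (fun s t => - ft s t).
Proof.
move=> [f1 f2 f3 f4 f5]; split=> s t Ps.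
- by have := is_deriveN (f1 s t Ps).
- by have := is_deriveN (f2 s t Ps).
- by apply: cont2N; auto.
- by apply: cont2N; auto.
- by apply: cont2N; auto.
Qed.

Lemma C1B P f fs ft g gs gt : C1 P f fs ft -> C1 P g gs gt ->
  C1 P (fun s t => f s t - g s t) (fun s t => fs s t - gs s t)
    (fun s t => ft s t - gt s t).
Proof. by move=> Cf Cg; apply: C1D => //; exact: C1N. Qed.

Lemma C1M P f fs ft g gs gt : C1 P f fs ft -> C1 P g gs gt ->
  C1 P (fun s t => f s t * g s t) (fun s t => fs s t * g s t + f s t * gs s t)
    (fun s t => ft s t * g s t + f s t * gt s t).
Proof.
move=> [f1 f2 f3 f4 f5] [g1 g2 g3 g4 g5]; split=> s t Ps.
- have := is_deriveM (f1 s t Ps) (g1 s t Ps).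
  by move=> /is_derive_eq; apply; rewrite /GRing.scale/= addrC [X in X + _]mulrC.
- have := is_deriveM (f2 s t Ps) (g2 s t Ps).
  by move=> /is_derive_eq; apply; rewrite /GRing.scale/= addrC [X in X + _]mulrC.
- by apply: cont2M; auto.
- by apply: cont2D; apply: cont2M; auto.
- by apply: cont2D; apply: cont2M; auto.
Qed.

Lemma C1_cst P (c : R) : C1 P (fun _ _ => c) (fun _ _ => 0) (fun _ _ => 0).
Proof.
by split=> s t _; try exact: cont2_cst; exact: is_derive_cst.
Qed.

Lemma C1_sum P (I : Type) (X : seq I) (F Fs Ft : I -> R -> R -> R) :
  (forall i, C1 P (F i) (Fs i) (Ft i)) ->
  C1 P (fun s t => \sum_(i <- X) F i s t) (fun s t => \sum_(i <- X) Fs i s t)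
    (fun s t => \sum_(i <- X) Ft i s t).
Proof.
move=> CF; elim: X => [|i X IH].
  have H (G : I -> R -> R -> R) : (fun s t => \sum_(i <- [::]) G i s t) = (fun _ _ => 0).
    by apply/funext => ?; apply/funext => ?; rewrite big_nil.
  by rewrite !H; exact: C1_cst.
have H (G : I -> R -> R -> R) : (fun s t => \sum_(i <- i :: X) G i s t) =
    (fun s t => G i s t + \sum_(i <- X) G i s t).
  by apply/funext => ?; apply/funext => ?; rewrite big_cons.
by rewrite !H; apply: C1D.
Qed.

(** Used to move an arbitrary point of the plane to the origin, the pole of the kernel. *)
Lemma C1_shift f fs ft (a b : R) : C1 setT f fs ft ->
  C1 setT (fun s t => f (a + s) (b + t)) (fun s t => fs (a + s) (b + t))
    (fun s t => ft (a + s) (b + t)).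
Proof.
have sh (g : R -> R -> R) s t : cont2 g (a + s) (b + t) ->
    cont2 (fun s t => g (a + s) (b + t)) s t.
  move=> cg; apply: (@continuous_comp _ _ _
    (fun p : R^o * R^o => (a + p.1, b + p.2) : R^o * R^o)
    (fun p : R^o * R^o => g p.1 p.2 : R^o)); last exact: cg.
  apply: continuous_pair; apply: cvgD; try exact: cvg_cst.
    exact: cvg_fst.
  exact: cvg_snd.
have ch (g : R^o -> R^o) (c x l : R) : is_derive (c + x) 1 g l ->
    is_derive (x : R^o) 1 (fun x => g (c + x) : R^o) l.
  move=> dg; have dc : is_derive (x : R^o) 1 (fun x : R^o => c + x : R^o) 1.
    by have := is_deriveD (is_derive_cst c x 1) (is_derive_id (x : R^o) 1); rewrite add0r.
  by have := is_derive1_comp dg dc; rewrite mulr1.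
move=> [f1 f2 f3 f4 f5]; split=> s t _.
- by apply: (ch (f^~ (b + t))); exact: f1.
- by apply: (ch (f (a + s))); exact: f2.
- by apply: sh; exact: f3.
- by apply: sh; exact: f4.
- by apply: sh; exact: f5.
Qed.

Lemma C1_sub (P P' : set R) f fs ft : P' `<=` P -> C1 P f fs ft -> C1 P' f fs ft.
Proof. by move=> sP [*]; split=> s t /sP; auto. Qed.

End C1.

(** * Differentiation of a line integral with respect to [s] *)

Section Contour.
Variables (R : realType) (L : R).
Hypothesis L0 : 0 < L.
Local Notation nz := [set s : R | s != 0].

Lemma C1_slice (P : set R) (f fs ft : R -> R -> R) s :
  C1 P f fs ft -> P s ->
  [/\ continuous (f s), continuous (fs s) & continuous (ft s)].
Proof. by move=> [_ _ f3 f4 f5] Ps; split=> t; apply: cont2_slice; auto. Qed.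

(* Differentiating under the integral, the [Ct] term costs nothing because [C] is periodic. *)
Lemma is_derive_integ (A As At C Cs Ct : R -> R -> R) :
  C1 nz A As At -> C1 nz C Cs Ct -> (forall s : R, s != 0 -> C s L = C s (- L)) ->
  forall s : R, s != 0 ->
  is_derive (s : R^o) 1 (fun s => integ L (A s) : R^o) (integ L (fun t => As s t - Ct s t)).
Proof.
move=> CA CC per s s0.
have [_ cAs _] := C1_slice CA s0; have [_ _ cCt] := C1_slice CC s0.
rewrite integB// (integ_derive L0 cCt (fun t => C1_t CC t s0)) per// subrr subr0.
(* Half the distance to [0] keeps a closed neighbourhood of [s] off the singular line, so that
   compactness gives a constant dominating [As]. *)
pose e := `|s| / 2; have e0 : 0 < e by rewrite divr_gt0 ?normr_gt0.
have nz' (x : R) : s - e <= x <= s + e -> x != 0.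
  move=> /andP[x1 x2]; apply/eqP => x0; move: x1 x2 e0; rewrite x0 /e.
  by case: (ger0P s) => ? ? ? ?; lra.
have [M M0 HM] := @cont2_rect_bounded _ As (s - e) (s + e) (- L) L
  (fun x t xs _ => C1_conts CA (nz' x xs)).
have p1 (x t : R) : x != 0 -> partial1of2 A x t = As x t.
  by move=> x0; rewrite partial1of2E; have [_ ->] := C1_s CA t x0.
have H := @derivable_under_integral R _ _ (@lebesgue_measure R) A `[- L, L]%classic
  _ s (s - e) (s + e) _ _ _ (fun=> M).
have H2 := @differentiation_under_integral R _ _ (@lebesgue_measure R) A `[- L, L]%classic
  _ s (s - e) (s + e) _ _ _ (fun=> M).
have Ix x : `]s - e, s + e[%classic x -> s - e <= x <= s + e.
  by rewrite /= in_itv/= => /andP[x1 x2]; rewrite !ltW.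
have Is : `]s - e, s + e[%classic s.
  by rewrite /= in_itv/= ltrBlDr ltrDl e0.
have h1 x : `]s - e, s + e[%classic x ->
    (@lebesgue_measure R).-integrable `[- L, L] (EFin \o A x).
  by move=> /Ix/nz' x0; apply: continuous_integrable; have [] := C1_slice CA x0.
have h2 x y : `]s - e, s + e[%classic x -> `[- L, L]%classic y -> derivable (A ^~ y) x 1.
  by move=> /Ix/nz' x0 _; have [] := C1_s CA y x0.
have h3 : (@lebesgue_measure R).-integrable `[- L, L] (EFin \o (fun=> M)).
  by apply: continuous_integrable; exact: cst_continuous.
have h4 x y : `]s - e, s + e[%classic x -> `[- L, L]%classic y ->
    `|partial1of2 A x y| <= M.
  by move=> /Ix xs ys; rewrite p1 ?nz'//; apply: HM => //; move: ys; rewrite /= in_itv.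
split; first by apply: H => //= _; exact: ltW.
rewrite -derive1E H2//; last by move=> _; exact: ltW.
by apply: eq_Rintegral => t _; exact: p1.
Qed.

End Contour.

(** * Holomorphic functions and the operator [d_s + i d_t] *)

Section Holomorphic.
Variable R : realType.
Implicit Types (P : set R).

Lemma C1V P (f fs ft : R -> R -> R) : (forall s t, P s -> f s t != 0) ->
  C1 P f fs ft ->
  C1 P (fun s t => (f s t)^-1) (fun s t => - (f s t)^-1 ^+ 2 * fs s t)
    (fun s t => - (f s t)^-1 ^+ 2 * ft s t).
Proof.
move=> f0 [f1 f2 f3 f4 f5]; split=> s t Ps; have fst0 := f0 s t Ps.
- have := @is_deriveV _ (f ^~ t) s _ _ fst0 (f1 s t Ps).
  by move=> /is_derive_eq; apply; rewrite /GRing.scale/= exprVn.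
- have := @is_deriveV _ (f s) t _ _ fst0 (f2 s t Ps).
  by move=> /is_derive_eq; apply; rewrite /GRing.scale/= exprVn.
- by apply: cont2V; auto.
- by apply: cont2M; [apply: cont2N; apply: cont2M; apply: cont2V|]; auto.
- by apply: cont2M; [apply: cont2N; apply: cont2M; apply: cont2V|]; auto.
Qed.

(* [p + i q] is a holomorphic function of [s + i t] *)
Definition hol P (p q : R -> R -> R) := exists2 d : (R -> R -> R) * (R -> R -> R),
  C1 P p d.1 d.2 & exists2 e : (R -> R -> R) * (R -> R -> R), C1 P q e.1 e.2 &
  forall s t, P s -> e.1 s t = - d.2 s t /\ e.2 s t = d.1 s t.

Lemma hol_cst P (c d : R) : hol P (fun _ _ => c) (fun _ _ => d).
Proof.
exists (fun _ _ => 0, fun _ _ => 0); first exact: C1_cst.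
exists (fun _ _ => 0, fun _ _ => 0); first exact: C1_cst.
by move=> s t _ /=; rewrite oppr0.
Qed.

Lemma holB P p q p' q' : hol P p q -> hol P p' q' ->
  hol P (fun s t => p s t - p' s t) (fun s t => q s t - q' s t).
Proof.
move=> [d pd [e qe de]] [d' pd' [e' qe' de']].
exists (fun s t => d.1 s t - d'.1 s t, fun s t => d.2 s t - d'.2 s t); first exact: C1B.
exists (fun s t => e.1 s t - e'.1 s t, fun s t => e.2 s t - e'.2 s t); first exact: C1B.
move=> s t Ps /=; have [-> ->] := de s t Ps; have [-> ->] := de' s t Ps.
by split=> //; ring.
Qed.

(** The two functions are the real and imaginary parts of [1 / (p + i q)]. *)
Lemma holV P p q : hol P p q -> (forall s t, P s -> p s t ^+ 2 + q s t ^+ 2 != 0) ->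
  hol P (fun s t => p s t / (p s t ^+ 2 + q s t ^+ 2))
        (fun s t => - (q s t / (p s t ^+ 2 + q s t ^+ 2))).
Proof.
move=> [d pd [e qe de]] N0.
have CN := C1D (C1M pd pd) (C1M qe qe).
have CV := C1V N0 CN.
have Cp := C1M pd CV; have Cq := C1N (C1M qe CV).
eexists (_, _); first exact: Cp.
eexists (_, _); first exact: Cq.
move=> s t Ps /=; have [-> ->] := de s t Ps.
have := N0 s t Ps; set x := p s t; set y := q s t.
rewrite !expr2 => n0; split; by field.
Qed.

(* [(alpha + i beta) exp (- mu (s + i t))] *)
Definition expp (mu al be s t : R) : R :=
  expR (- mu * s) * (al * cos (mu * t) + be * sin (mu * t)).
Definition expq (mu al be s t : R) : R :=
  expR (- mu * s) * (be * cos (mu * t) - al * sin (mu * t)).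

Lemma C1_expp P mu al be :
  C1 P (expp mu al be) (fun s t => - mu * expp mu al be s t)
    (fun s t => mu * expq mu al be s t).
Proof.
have cM (c x : R) : {for x, continuous ((fun x => c * x) : R^o -> R^o)}.
  by apply: cvgM; [exact: cvg_cst|exact: cvg_id].
have ce s : {for s, continuous ((fun s => expR (- mu * s)) : R^o -> R^o)}.
  apply: (@continuous_comp _ _ _ (fun s => - mu * s) (@expR R)); first exact: cM.
  exact: continuous_expR.
have cc t : {for t, continuous ((fun t => cos (mu * t)) : R^o -> R^o)}.
  apply: (@continuous_comp _ _ _ (fun s => mu * s) (@cos R)); first exact: cM.
  exact: continuous_cos.
have cs t : {for t, continuous ((fun t => sin (mu * t)) : R^o -> R^o)}.
  apply: (@continuous_comp _ _ _ (fun s => mu * s) (@sin R)); first exact: cM.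
  exact: continuous_sin.
have cp s t : cont2 (expp mu al be) s t.
  apply: cont2M; first exact: (@cont2_fst _ (fun s => expR (- mu * s))).
  by apply: cont2D; apply: cont2M; try exact: cont2_cst;
    [exact: (@cont2_snd _ (fun t => cos (mu * t)))
    |exact: (@cont2_snd _ (fun t => sin (mu * t)))].
have cq s t : cont2 (expq mu al be) s t.
  apply: cont2M; first exact: (@cont2_fst _ (fun s => expR (- mu * s))).
  by apply: cont2B; apply: cont2M; try exact: cont2_cst;
    [exact: (@cont2_snd _ (fun t => cos (mu * t)))
    |exact: (@cont2_snd _ (fun t => sin (mu * t)))].
have dM (c x : R) : is_derive (x : R^o) 1 ((fun x => c * x) : R^o -> R^o) c.
  have := is_deriveM (is_derive_cst c x 1) (is_derive_id (x : R^o) 1).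
  by move=> /is_derive_eq; apply; rewrite /GRing.scale/=; ring.
split=> s t _ //.
- have de := is_derive1_comp (is_derive_expR (- mu * s)) (dM (- mu) s).
  have := is_deriveM de (is_derive_cst (al * cos (mu * t) + be * sin (mu * t)) s 1).
  by move=> /is_derive_eq; apply; rewrite /GRing.scale/= /expp; ring.
- have dc := is_derive1_comp (is_derive_cos (mu * t)) (dM mu t).
  have ds := is_derive1_comp (is_derive_sin (mu * t)) (dM mu t).
  have := is_deriveM (is_derive_cst (expR (- mu * s)) t 1)
    (is_deriveD (is_deriveM (is_derive_cst al t 1) dc) (is_deriveM (is_derive_cst be t 1) ds)).
  by move=> /is_derive_eq; apply; rewrite /GRing.scale/= /expq; ring.
- by apply: cont2M; [exact: cont2_cst|].
- by apply: cont2M; [exact: cont2_cst|].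
Qed.

(** The imaginary part of a number is the real part of its product with [- i]; hence differentiating
    [expp] suffices. *)
Lemma expqE mu al be : expq mu al be = expp mu be (- al).
Proof. by apply/funext => s; apply/funext => t; rewrite /expq /expp (mulNr al). Qed.

Lemma exppN mu al be s t : expp mu (- al) (- be) s t = - expp mu al be s t.
Proof. by rewrite /expp; ring. Qed.

Lemma hol_exp P mu al be : hol P (expp mu al be) (expq mu al be).
Proof.
eexists (_, _); first exact: C1_expp.
eexists (_, _); first by rewrite expqE; exact: C1_expp.
by move=> s t _ /=; rewrite !expqE exppN; split; ring.
Qed.

Lemma expp_sqD mu al be s t :
  expp mu al be s t ^+ 2 + expq mu al be s t ^+ 2 =
  expR (- mu * s) ^+ 2 * (al ^+ 2 + be ^+ 2).
Proof.
rewrite /expp /expq; set c := cos _; set d := sin _; set r := expR _.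
have e : c ^+ 2 + d ^+ 2 = 1 by exact: cos2Dsin2.
transitivity (r ^+ 2 * (al ^+ 2 + be ^+ 2) * (c ^+ 2 + d ^+ 2)); first by ring.
by rewrite e mulr1.
Qed.

(* [(d_s + i d_t) (x + i y) = e1 + i e2] *)
Definition dbar P (x y e1 e2 : R -> R -> R) :=
  exists2 d : (R -> R -> R) * (R -> R -> R), C1 P x d.1 d.2 &
  exists2 e : (R -> R -> R) * (R -> R -> R), C1 P y e.1 e.2 &
  forall s t, P s -> d.1 s t - e.2 s t = e1 s t /\ e.1 s t + d.2 s t = e2 s t.

Lemma dbar_hol P p q : hol P p q -> dbar P p q (fun _ _ => 0) (fun _ _ => 0).
Proof.
move=> [d pd [e qe de]]; exists d => //; exists e => // s t Ps.
by have [-> ->] := de s t Ps; split; ring.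
Qed.

(** Leibniz rule: [d_s + i d_t] annihilates the holomorphic factor [p + i q], which therefore just
    multiplies the right-hand side. *)
Lemma dbar_holM P p q x y e1 e2 : hol P p q -> dbar P x y e1 e2 ->
  dbar P (fun s t => p s t * x s t - q s t * y s t)
         (fun s t => p s t * y s t + q s t * x s t)
         (fun s t => p s t * e1 s t - q s t * e2 s t)
         (fun s t => p s t * e2 s t + q s t * e1 s t).
Proof.
move=> [d pd [e qe de]] [a xa [b yb ab]].
eexists (_, _); first exact: C1B (C1M pd xa) (C1M qe yb).
eexists (_, _); first exact: C1D (C1M pd yb) (C1M qe xa).
move=> s t Ps /=; have [-> ->] := de s t Ps; have [<- <-] := ab s t Ps.
by split; ring.
Qed.

Lemma dbar_sum P (I : Type) (X : seq I) (x y e f : I -> R -> R -> R) :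
  (forall i, dbar P (x i) (y i) (e i) (f i)) ->
  dbar P (fun s t => \sum_(i <- X) x i s t) (fun s t => \sum_(i <- X) y i s t)
    (fun s t => \sum_(i <- X) e i s t) (fun s t => \sum_(i <- X) f i s t).
Proof.
move=> H; pose T := ((R -> R -> R) * (R -> R -> R))%type.
have /choice[D HD] : forall i, exists de : T * T,
  [/\ C1 P (x i) de.1.1 de.1.2, C1 P (y i) de.2.1 de.2.2 & forall s t, P s ->
  de.1.1 s t - de.2.2 s t = e i s t /\ de.2.1 s t + de.1.2 s t = f i s t].
  by move=> i; have [d xd [d' yd dd]] := H i; exists (d, d').
eexists (_, _).
  by apply: (@C1_sum _ _ _ X x (fun i => (D i).1.1) (fun i => (D i).1.2)) => i; have [] := HD i.
eexists (_, _).
  by apply: (@C1_sum _ _ _ X y (fun i => (D i).2.1) (fun i => (D i).2.2)) => i; have [] := HD i.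
move=> s t Ps /=; rewrite -sumrB -big_split/=.
by split; apply: eq_bigr => i _; have [_ _ /(_ s t Ps)[]] := HD i.
Qed.

Lemma dbar_sub P P' x y e f : P' `<=` P -> dbar P x y e f -> dbar P' x y e f.
Proof.
move=> sP [d pd [d' qe de]]; exists d; first exact: C1_sub pd.
by exists d'; [exact: C1_sub qe|move=> s t /sP; exact: de].
Qed.

End Holomorphic.

(** * The periodic Cauchy kernel and its Poisson kernel *)

Section Kernel.
Variables (R : realType) (ka : R).
Hypothesis ka0 : 0 < ka.
Local Notation nz := [set s : R | s != 0].
Local Notation r s := (expR (- ka * s)).

Let u (s t : R) : R := 1 - expp ka 1 0 s t.
Let v (s t : R) : R := 0 - expq ka 1 0 s t.
Let N (s t : R) : R := u s t ^+ 2 + v s t ^+ 2.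

(* Real and imaginary parts of [1 / (1 - exp (- ka (s + i t)))] *)
Definition KP (s t : R) : R := u s t / N s t.
Definition KQ (s t : R) : R := - (v s t / N s t).

(** With [w = exp (- ka (s + i t))], so that [|w| = r s], this splits [|1 - w| ^ 2] into a radial
    part, nonzero off [s = 0], and an angular part, quadratic in [t] near [0]. *)
Let NE s t : N s t = (1 - r s) ^+ 2 + 2 * r s * (1 - cos (ka * t)).
Proof.
rewrite /N /u /v /expp /expq; have := cos2Dsin2 (ka * t).
set c := cos _; set d := sin _; set x := expR _ => e.
transitivity (1 - 2 * x * c + x ^+ 2 * (c ^+ 2 + d ^+ 2)); first by ring.
by rewrite e; ring.
Qed.

Let N_ge s t : (1 - r s) ^+ 2 <= N s t.
Proof.
rewrite NE lerDl; apply: mulr_ge0; first by rewrite mulr_ge0// expR_ge0.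
by rewrite subr_ge0 cos_le1.
Qed.

Let r1 s : s != 0 -> 1 - r s != 0.
Proof.
move=> s0; rewrite subr_eq0 eq_sym -expR0; apply: contra s0 => /eqP/expR_inj/eqP.
by rewrite mulf_eq0 oppr_eq0 gt_eqF.
Qed.

Let N0 s t : s != 0 -> 0 < N s t.
Proof. by move=> /r1 s0; apply: lt_le_trans (N_ge s t); rewrite exprn_even_gt0. Qed.

Lemma hol_K : hol nz KP KQ.
Proof.
apply: holV; last by move=> s t s0; rewrite gt_eqF//; exact: N0.
by apply: holB; [exact: hol_cst|exact: hol_exp].
Qed.

Lemma K_periodic s t : cos (ka * t) = cos (ka * - t) -> sin (ka * t) = sin (ka * - t) ->
  KP s t = KP s (- t) /\ KQ s t = KQ s (- t).
Proof. by rewrite /KP /KQ /N /u /v /expp /expq => -> ->. Qed.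

Let rN s : r (- s) = (r s)^-1.
Proof. by rewrite mulrN expRN. Qed.

Let r01 s : 0 < s -> 0 < r s < 1.
Proof.
by move=> s0; rewrite expR_gt0 -[X in _ < X]expR0 ltr_expR mulNr oppr_lt0 mulr_gt0.
Qed.

Let KPE s t : KP s t = (1 - r s * cos (ka * t)) / N s t.
Proof. by rewrite /KP /u /expp; congr (_ / _); ring. Qed.

Let KQE s t : KQ s t = - (r s * sin (ka * t)) / N s t.
Proof. by rewrite /KQ [RHS]mulNr; congr (- (_ / _)); rewrite /v /expq; ring. Qed.

(** The reflection [s -> - s] sends [w = exp (- ka (s + i t))] to [1 / conj w], and
    [|1 - 1 / conj w| = |1 - w| / |w|]. *)
Let N_opp s t : N (- s) t = N s t / r s ^+ 2.
Proof. by rewrite !NE rN; field; rewrite gt_eqF// expR_gt0. Qed.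

Let KPN s t : s != 0 -> KP (- s) t = r s * (r s - cos (ka * t)) / N s t.
Proof.
move=> s0; rewrite KPE N_opp rN; field.
by rewrite !gt_eqF ?N0 ?expR_gt0.
Qed.

Let KQN s t : s != 0 -> KQ (- s) t = KQ s t.
Proof.
move=> s0; rewrite !KQE N_opp rN; field.
by rewrite !gt_eqF ?N0 ?expR_gt0.
Qed.

(** The difference across the line [s = 0] of the real part of the kernel; for [s > 0] it is the
    Poisson kernel of the unit disc at radius [r s]. The imaginary part has no such difference, by
    [KQN]. *)
Definition poisson s t : R := KP s t - KP (- s) t.

Let poissonE s t : s != 0 -> poisson s t = (1 - r s ^+ 2) / N s t.
Proof.
move=> s0; rewrite /poisson KPN// KPE -mulrBl; congr (_ / _); ring.
Qed.

(* For [|z| = exp (- ka s)], AM-GM bounds [1 / |1 - z|] by [(poisson + 1) / (2 gap)],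
   where [poisson = (1 - |z|^2) / |1 - z|^2] has a known integral in [t]. *)
Definition gap s : R := Num.sqrt (1 - r s ^+ 2).

Let gap2 s : 0 < s -> 0 < 1 - r s ^+ 2.
Proof.
move=> /r01/andP[r0 r1']; rewrite subr_gt0 expr_lt1//; exact: ltW.
Qed.

Lemma gap_gt0 s : 0 < s -> 0 < gap s.
Proof. by move=> s0; rewrite sqrtr_gt0 gap2. Qed.

Let gap_sq s : 0 < s -> gap s ^+ 2 = 1 - r s ^+ 2.
Proof. by move=> s0; rewrite sqr_sqrtr// ltW// gap2. Qed.

Lemma poisson_ge0 s t : 0 < s -> 0 <= poisson s t.
Proof.
by move=> s0; rewrite poissonE ?gt_eqF// divr_ge0 ?ltW// ?gap2// N0// gt_eqF.
Qed.

Let amgm (x a n : R) : 0 < a -> 0 < n -> x ^+ 2 <= n^-1 ->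
  `|x| <= (a ^+ 2 / n + 1) / (2 * a).
Proof.
move=> a0 n0 xn; rewrite ler_pdivlMr ?mulr_gt0//.
have : a ^+ 2 * x ^+ 2 <= a ^+ 2 / n by rewrite ler_wpM2l ?sqr_ge0.
rewrite -(real_normK (num_real x)); have := sqr_ge0 (a * `|x| - 1); nra.
Qed.

Let NE' s t : N s t = (1 - r s * cos (ka * t)) ^+ 2 + (r s * sin (ka * t)) ^+ 2.
Proof. by rewrite /N /u /v /expp /expq; ring. Qed.

Let le_inv (x y n : R) : 0 < n -> x ^+ 2 + y ^+ 2 = n ->
  (x / n) ^+ 2 <= n^-1 /\ (y / n) ^+ 2 <= n^-1.
Proof.
move=> n0 e.
have H z w : z ^+ 2 + w ^+ 2 = n -> (z / n) ^+ 2 <= n^-1.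
  move=> e'; rewrite expr_div_n ler_pdivrMr ?exprn_gt0// expr2 mulrA mulVf ?gt_eqF//.
  by rewrite mul1r -e' lerDl sqr_ge0.
by split; [exact: (H x y)|apply: (H y x); rewrite addrC].
Qed.

Let K_sq s t : s != 0 -> KP s t ^+ 2 <= (N s t)^-1 /\ KQ s t ^+ 2 <= (N s t)^-1.
Proof.
by move=> s0; rewrite KPE KQE; apply: le_inv; rewrite ?N0// NE' sqrrN.
Qed.

Let KN_sq s t : s != 0 ->
  (KP (- s) t / r s) ^+ 2 <= (N s t)^-1 /\ (KQ (- s) t / r s) ^+ 2 <= (N s t)^-1.
Proof.
move=> s0; have rr : r s != 0 by rewrite gt_eqF// expR_gt0.
have -> : KP (- s) t / r s = (r s - cos (ka * t)) / N s t.
  by rewrite KPN//; field; rewrite rr gt_eqF// N0.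
have -> : KQ (- s) t / r s = - sin (ka * t) / N s t.
  by rewrite KQN// KQE; field; rewrite rr gt_eqF// N0.
apply: le_inv; rewrite ?N0// NE'; have := cos2Dsin2 (ka * t).
set c := cos _; set d := sin _; set x := expR _ => e.
transitivity (x ^+ 2 * (c ^+ 2 + d ^+ 2) + (c ^+ 2 + d ^+ 2) - 2 * x * c); last by rewrite {2}e; ring.
by rewrite {1}e; ring.
Qed.

Lemma K_le s t : 0 < s -> `|KP s t| <= (poisson s t + 1) / (2 * gap s) /\
  `|KQ s t| <= (poisson s t + 1) / (2 * gap s).
Proof.
move=> s0; have s0' : s != 0 by rewrite gt_eqF.
have [h1 h2] := K_sq t s0'; rewrite poissonE// -gap_sq//.
by split; apply: amgm; rewrite ?gap_gt0 ?N0.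
Qed.

Lemma KN_le s t : 0 < s ->
  `|KP (- s) t| <= r s * ((poisson s t + 1) / (2 * gap s)) /\
  `|KQ (- s) t| <= r s * ((poisson s t + 1) / (2 * gap s)).
Proof.
move=> s0; have s0' : s != 0 by rewrite gt_eqF.
have [h1 h2] := KN_sq t s0'; rewrite poissonE// -gap_sq//.
have H x : (x / r s) ^+ 2 <= (N s t)^-1 ->
    `|x| <= r s * ((gap s ^+ 2 / N s t + 1) / (2 * gap s)).
  move=> hx; have : `|x / r s| <= (gap s ^+ 2 / N s t + 1) / (2 * gap s).
    by apply: amgm; rewrite ?gap_gt0 ?N0.
  by rewrite normf_div (gtr0_norm (expR_gt0 _)) ler_pdivrMr ?expR_gt0// mulrC.
by split; exact: H.
Qed.

Lemma KQN_eq s t : 0 < s -> KQ (- s) t = KQ s t.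
Proof. by move=> s0; apply: KQN; rewrite gt_eqF. Qed.

(** If [|w| <= 1/2] then [|1 - w| ^ 2 >= 1/4]. The last bound makes the Poisson kernel tend to [1]
    uniformly in [t] as [s] grows. *)
Lemma K_far s t : 0 < s -> r s <= 2^-1 ->
  [/\ `|KP s t| <= 2, `|KQ s t| <= 2, `|KP (- s) t| <= 2 * r s,
      `|KQ (- s) t| <= 2 * r s & `|poisson s t - 1| <= 16 * r s].
Proof.
move=> s0 r2; have s0' : s != 0 by rewrite gt_eqF.
have /andP[r0 _] := r01 s0.
have Nge : 4^-1 <= N s t by apply: le_trans (N_ge s t); nra.
have N0' := N0 t s0'.
have iN : (N s t)^-1 <= 4 by rewrite -[leRHS]invrK lef_pV2 ?posrE ?invr_gt0.
have H x : x ^+ 2 <= (N s t)^-1 -> `|x| <= 2.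
  move=> hx; rewrite -(@ler_pXn2r _ 2%N) ?nnegrE// real_normK ?num_real//.
  by apply: le_trans hx _; apply: le_trans iN _; lra.
have [h1 h2] := K_sq t s0'; have [h3 h4] := KN_sq t s0'.
have H' x : (x / r s) ^+ 2 <= (N s t)^-1 -> `|x| <= 2 * r s.
  by move=> /H; rewrite normf_div (gtr0_norm r0) ler_pdivrMr.
split; [exact: H|exact: H|exact: H'|exact: H'|].
have -> : poisson s t - 1 = r s * (2 * (cos (ka * t) - r s)) / N s t.
  apply: (@mulIf _ (N s t)); first by rewrite gt_eqF.
  rewrite poissonE// mulrBl !divfK ?gt_eqF// NE; ring.
rewrite !normrM (gtr0_norm r0) normfV (gtr0_norm N0') -[leRHS]mulrC -!mulrA.
apply: ler_wpM2l; first exact: ltW.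
have -> : 16 = 2 * 2 * 4 :> R by ring.
rewrite mulrA; apply: ler_pM => //; first by rewrite invr_ge0 ltW.
rewrite (ger0_norm (ltW _))//; apply: ler_wpM2l => //.
rewrite (le_trans (ler_normB _ _))// (gtr0_norm r0).
have := cos_max (ka * t); lra.
Qed.

Lemma gap_le s : 0 < s -> gap s <= Num.sqrt (2 * ka) * Num.sqrt s.
Proof.
move=> s0; rewrite /gap -sqrtrM ?mulr_ge0 ?(ltW ka0)//; apply: ler_wsqrtr.
rewrite -expRM_natl; have := expR_ge1Dx (2 * (- ka * s)); lra.
Qed.

(** From [exp (2 ka s) >= 1 + 2 ka s] one gets [gap ^ 2 >= 2 ka s / (1 + 2 ka s)]. The factor
    [(1 + sqrt s) / sqrt s] is the one that appears in the derivative of [prim] below. *)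
Lemma gapV_le s : 0 < s ->
  (gap s)^-1 <= Num.sqrt ((1 + 2 * ka) / (2 * ka)) * ((1 + Num.sqrt s) / Num.sqrt s).
Proof.
move=> s0; have q0 : 0 < Num.sqrt s by rewrite sqrtr_gt0.
have k2 : 0 < 2 * ka by rewrite mulr_gt0.
have C0 : 0 <= (1 + 2 * ka) / (2 * ka) by rewrite divr_ge0 ?addr_ge0 ?ltW.
have y0 : 0 <= (1 + Num.sqrt s) / Num.sqrt s by rewrite divr_ge0 ?addr_ge0 ?ltW.
rewrite -(ger0_norm y0) -sqrtr_sqr -sqrtrM//.
have g0 : 0 <= (gap s)^-1 by rewrite invr_ge0 ltW// gap_gt0.
rewrite -(ger0_norm g0) -sqrtr_sqr; apply: ler_wsqrtr.
rewrite exprVn gap_sq// expr_div_n sqr_sqrtr; last exact: ltW.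
have Z0 : 0 < (1 + 2 * ka) / (2 * ka) * ((1 + Num.sqrt s) ^+ 2 / s).
  by apply: mulr_gt0; apply: divr_gt0; rewrite ?exprn_gt0 ?addr_gt0.
rewrite invf_ple ?posrE ?gap2//.
have e1 : r s ^+ 2 <= (1 + 2 * ka * s)^-1.
  rewrite -expRM_natl mulrA mulrN mulNr expRN lef_pV2 ?posrE ?expR_gt0//.
    exact: expR_ge1Dx.
  by rewrite addr_gt0 ?mulr_gt0.
have e2 : ((1 + 2 * ka) / (2 * ka) * ((1 + Num.sqrt s) ^+ 2 / s))^-1 <=
   1 - (1 + 2 * ka * s)^-1; last by lra.
have -> : 1 - (1 + 2 * ka * s)^-1 = ((1 + 2 * ka * s) / (2 * ka * s))^-1.
  by field; rewrite ?gt_eqF ?addr_gt0 ?mulr_gt0.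
rewrite lef_pV2 ?posrE//; last by rewrite divr_gt0 ?addr_gt0 ?mulr_gt0.
have -> : (1 + 2 * ka) / (2 * ka) * ((1 + Num.sqrt s) ^+ 2 / s) =
  ((1 + 2 * ka) * (1 + Num.sqrt s) ^+ 2) / (2 * ka * s).
  by field; rewrite !gt_eqF.
rewrite ler_pM2r ?invr_gt0 ?mulr_gt0//.
have -> : (1 + Num.sqrt s) ^+ 2 = 1 + 2 * Num.sqrt s + s.
  by rewrite -{3}(sqr_sqrtr (ltW s0)); ring.
have := mulr_gt0 ka0 q0; have := mulr_gt0 ka0 s0; lra.
Qed.

(** With [y = x / 4], [1 - cos x = 8 sin(y)^2 cos(y)^2]; on [[0, pi / 4]] one has [cos(y)^2 >= 1/2],
    and [sin y >= y cos (pi / 4)] by the mean value theorem. *)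
Lemma one_sub_cos_ge (x : R) : - pi <= x <= pi -> x ^+ 2 / 8 <= 1 - cos x.
Proof.
wlog x0 : x / 0 <= x.
  move=> H /andP[x1 x2]; case: (lerP 0 x) => x0; first by apply: H => //; rewrite x1.
  by rewrite -cosN -sqrrN; apply: H; [rewrite oppr_ge0 ltW|rewrite lerN2 x2/= lerNl].
move=> /andP[_ xpi].
pose y := x / 4.
have y0 : 0 <= y by rewrite divr_ge0.
have pi0 := @pi_gt0 R.
have ypi : y <= pi / 4 by rewrite ler_pM2r ?invr_gt0.
have c4 : cos (pi / 4 : R) ^+ 2 = 2^-1.
  have := cos_mulr2n (pi / 4 : R); have -> : (pi / 4 : R) *+ 2 = pi / 2 by lra.
  by rewrite cos_pihalf -mulr_natr; lra.
have c40 : 0 <= cos (pi / 4 : R) by apply: cos_ge0_pihalf; apply/andP; split; lra.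
have cge (z : R) : 0 <= z <= pi / 4 -> cos (pi / 4 : R) <= cos z.
  move=> /andP[z0 z1]; rewrite leNgt ltr_cos -?leNgt// in_itv/=; apply/andP; split; lra.
have sge : y * cos (pi / 4) <= sin y.
  have [z zy] := @MVT_segment R sin cos 0 y y0 (fun x _ => is_derive_sin x)
    (continuous_subspaceT (@continuous_sin R)).
  rewrite sin0 !subr0 => ->; rewrite mulrC; apply: ler_wpM2r => //.
  move: zy; rewrite in_itv/= => /andP[z0 z1]; apply: cge; rewrite z0/=; exact: le_trans ypi.
have s0 : 0 <= sin y by apply: le_trans sge; rewrite mulr_ge0.
have cy := cge y; rewrite y0 ypi in cy; have {}cy := cy isT.
have s2 : y ^+ 2 / 2 <= sin y ^+ 2.
  by rewrite -c4 -exprMn ler_sqr ?nnegrE// mulr_ge0.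
have c2 : 2^-1 <= cos y ^+ 2 by rewrite -c4 ler_sqr ?nnegrE//; exact: le_trans cy.
have -> : x = (y *+ 2) *+ 2 by rewrite /y; lra.
rewrite cos_mulr2n; have -> : cos (y *+ 2) ^+ 2 = 1 - sin (y *+ 2) ^+ 2.
  by rewrite cos2sin2.
rewrite sin_mulr2n ![_ *+ 2]mulr2n.
have : 2^-1 * (y ^+ 2 / 2) <= cos y ^+ 2 * sin y ^+ 2.
  by apply: ler_pM => //; rewrite divr_ge0 ?sqr_ge0.
lra.
Qed.

(** Once integrated, this says that the first moment of the Poisson kernel is [O(gap s)], which
    makes it an approximate identity at [t = 0] as [s] tends to [0]. AM-GM gives it from
    [t ^ 2 <= C2 * N s t]. *)
Lemma poisson_norm_le s t : 0 < s <= 1 -> `|ka * t| <= pi ->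
  poisson s t * `|t| <=
  Num.sqrt (4 * expR ka / ka ^+ 2) * (gap s / 2) * (1 + poisson s t).
Proof.
move=> /andP[s0 s1] tpi; have s0' : s != 0 by rewrite gt_eqF.
have g0 := gap_gt0 s0; have n0 := N0 t s0'; have p0 := poisson_ge0 t s0.
(* [C2] inverts the coefficient of [t ^ 2] in [2 exp (- ka) (ka t) ^ 2 / 8 <= N s t], where
   [exp (- ka) <= r s] because [s <= 1]. *)
set C2 := _ / _ ^+ 2; have C20 : 0 < C2 by rewrite divr_gt0 ?mulr_gt0 ?expR_gt0 ?exprn_gt0.
set C := Num.sqrt C2; have C0 : 0 < C by rewrite sqrtr_gt0.
have CC : C ^+ 2 = C2 by rewrite sqr_sqrtr// ltW.
have tN : t ^+ 2 <= C2 * N s t.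
  have h : (ka * t) ^+ 2 / 8 <= 1 - cos (ka * t) by apply: one_sub_cos_ge; rewrite -ler_norml.
  have rk : expR (- ka) <= r s.
    by rewrite ler_expR mulNr lerN2 ler_piMr// ltW.
  have : 2 * expR (- ka) * ((ka * t) ^+ 2 / 8) <= N s t.
    rewrite NE; apply: ler_wpDl; first exact: sqr_ge0.
    apply: ler_pM => //; last by rewrite ler_pM2l.
    by rewrite divr_ge0 ?sqr_ge0.
  rewrite -(ler_pM2l C20); apply: le_trans; rewrite le_eqVlt; apply/orP; left; apply/eqP.
  by rewrite /C2 expRN; field; rewrite !gt_eqF ?expR_gt0.
have tt : `|t| * (2 * gap s) <= C * (N s t + gap s ^+ 2).
  have : `|t| ^+ 2 <= C ^+ 2 * N s t by rewrite CC real_normK ?num_real.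
  set a := `|t| => h; set g := gap s.
  have h1 := sqr_ge0 (a - C * g).
  by rewrite -(ler_pM2l C0); lra.
have P1 : poisson s t = gap s ^+ 2 / N s t by rewrite poissonE// gap_sq.
have : poisson s t * (`|t| * (2 * gap s)) <= poisson s t * (C * (N s t + gap s ^+ 2)).
  by rewrite ler_wpM2l.
have -> : poisson s t * (C * (N s t + gap s ^+ 2)) =
  C * gap s ^+ 2 * (1 + poisson s t).
  by rewrite P1; field; rewrite gt_eqF.
move=> h; rewrite -(@ler_pM2r _ (2 * gap s)) ?mulr_gt0//.
rewrite -(mulrA (poisson s t)); apply: le_trans h _; lra.
Qed.

End Kernel.

(** * Consequences of the mean value theorem *)

Section MeanValue.
Variable R : realType.
Implicit Types f df : R -> R.
Local Notation der f x df := (is_derive (x : R^o) 1 (f : R^o -> R^o) df).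

Lemma is_derive_continuous f df x : der f x (df x) -> {for x, continuous f}.
Proof.
by move=> [dfx _]; apply: differentiable_continuous; exact/derivable1_diffP.
Qed.

Lemma derive_MVT f df (a b : R) : a <= b ->
  (forall x, a <= x <= b -> der f x (df x)) ->
  exists2 c, a <= c <= b & f b - f a = df c * (b - a).
Proof.
move=> ab fdf; have [||c cab e] := @MVT_segment R f df a b ab.
- by move=> x; rewrite in_itv/= => /andP[ax xb]; apply: fdf; rewrite !ltW.
- apply: continuous_in_subspaceT => x; rewrite inE/= in_itv/= => xab.
  exact: is_derive_continuous (fdf x xab).
- by exists c => //; move: cab; rewrite in_itv.
Qed.

Lemma lipschitz_derive f df (a b M u v : R) :
  (forall x, a <= x <= b -> der f x (df x)) ->
  (forall x, a <= x <= b -> `|df x| <= M) ->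
  a <= u <= b -> a <= v <= b -> `|f u - f v| <= M * `|u - v|.
Proof.
move=> fdf dfM; wlog uv : u v / v <= u.
  move=> H ua va; case/orP: (le_total v u) => vu; first exact: H.
  by rewrite distrC (distrC u); exact: H.
move=> /andP[au ub] /andP[av vb].
have sub x : v <= x <= u -> a <= x <= b.
  by move=> /andP[vx xu]; rewrite (le_trans av vx) (le_trans xu ub).
have [c /sub cvu ->] := derive_MVT uv (fun x xvu => fdf x (sub x xvu)).
by rewrite normrM ler_wpM2r// dfM.
Qed.

(** The functions [g + f] and [g - f] have nonnegative derivatives. This comparison with a primitive
    stands in for integration in [s]. *)
Lemma le_of_derive f g df dg (a b : R) : a <= b ->
  (forall x, a <= x <= b -> der f x (df x)) ->
  (forall x, a <= x <= b -> der g x (dg x)) ->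
  (forall x, a <= x <= b -> `|df x| <= dg x) ->
  `|f b - f a| <= g b - g a.
Proof.
move=> ab Df Dg H; rewrite ler_norml; apply/andP; split.
  have [c cab] := @derive_MVT (fun x => g x + f x) (fun x => dg x + df x) a b ab
    (fun x xab => is_deriveD (Dg x xab) (Df x xab)).
  suff : 0 <= (dg c + df c) * (b - a) by lra.
  by apply: mulr_ge0; [have := H c cab; rewrite ler_norml|rewrite subr_ge0]; lra.
have [c cab] := @derive_MVT (fun x => g x - f x) (fun x => dg x - df x) a b ab
  (fun x xab => is_deriveB (Dg x xab) (Df x xab)).
suff : 0 <= (dg c - df c) * (b - a) by lra.
by apply: mulr_ge0; [have := H c cab; rewrite ler_norml|rewrite subr_ge0]; lra.
Qed.

Lemma C1_lipschitz (L : R) (f fs ft : R -> R -> R) : 0 < L -> C1 setT f fs ft ->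
  exists2 M : R, 0 < M & forall s s' t, `|s| <= 1 -> `|s'| <= 1 -> `|t| <= L ->
    `|f s t - f s' t| <= M * `|s - s'| /\ `|f s t - f s 0| <= M * `|t|.
Proof.
move=> L0 [f1 f2 _ f4 f5].
have [M1 M10 HM1] := @cont2_rect_bounded _ fs (- 1) 1 (- L) L (fun s t _ _ => f4 s t I).
have [M2 M20 HM2] := @cont2_rect_bounded _ ft (- 1) 1 (- L) L (fun s t _ _ => f5 s t I).
exists (M1 + M2); first by rewrite addr_gt0.
move=> s s' t s1 s1' tL; split.
  apply: (@le_trans _ _ (M1 * `|s - s'|)); last by rewrite ler_wpM2r// lerDl ltW.
  apply: (@lipschitz_derive (f ^~ t) (fs ^~ t) (- 1) 1); rewrite -?ler_norml//.
    by move=> x _; exact: f1.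
  by move=> x x1; apply: HM1 => //; rewrite -ler_norml.
apply: (@le_trans _ _ (M2 * `|t|)); last by rewrite ler_wpM2r// lerDr ltW.
rewrite -{2}[t]subr0.
apply: (@lipschitz_derive (f s) (ft s) (- L) L); rewrite -?ler_norml ?normr0 ?(ltW L0)//.
  by move=> x _; exact: f2.
by move=> x x1; apply: HM2 => //; rewrite -ler_norml.
Qed.

End MeanValue.

(** * Cauchy's formula on the cylinder of circumference [2 L] *)

Section Cylinder.
Variables (R : realType) (L eta : R).
Hypotheses (L0 : 0 < L) (eta0 : 0 < eta).
Local Notation nz := [set s : R | s != 0].
Local Notation der f x df := (is_derive (x : R^o) 1 (f : R^o -> R^o) df).
Let ka := pi / L.

Let ka0 : 0 < ka. Proof. by rewrite divr_gt0// pi_gt0. Qed.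

Let kaL : ka * L = pi. Proof. by rewrite /ka divfK// gt_eqF. Qed.

(** Comparable to [s ^ (- 1 - eta)] at infinity and equal to [1] at [0]; written in [1 + sqrt s] so
    that its product with [(1 + sqrt s) / sqrt s] has an elementary primitive. *)
Definition decay (s : R) : R := (1 + Num.sqrt s) `^ (- (2 + 2 * eta)).

Lemma dbar_integ (A C E F : R -> R -> R) : dbar nz A C E F ->
  (forall s : R, s != 0 -> C s L = C s (- L)) ->
  forall s : R, s != 0 ->
  [/\ continuous (A s), continuous (E s) &
      der (fun s => integ L (A s)) s (integ L (E s))].
Proof.
move=> [[As At] /= CA [[Cs Ct] /= CC AC]] per s s0.
have [cA cAs _] := C1_slice CA s0; have [_ _ cCt] := C1_slice CC s0.
have E_ : E s = (fun t => As s t - Ct s t).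
  by apply/funext => t; have [<-] := AC s t s0.
split=> //; first by rewrite E_ => t; apply: cvgB; [exact: cAs|exact: cCt].
by rewrite E_; exact: (is_derive_integ L0 CA CC).
Qed.

(* The integral over the line at [s] minus that over the line at [- s]; as [s] tends to
   [0] it picks up the pole of the kernel at the origin. *)
Definition jump (A : R -> R -> R) s := integ L (A s) - integ L (A (- s)).

Lemma is_derive_jump (A C E F : R -> R -> R) : dbar nz A C E F ->
  (forall s : R, s != 0 -> C s L = C s (- L)) ->
  forall s : R, s != 0 -> der (jump A) s (integ L (E s) + integ L (E (- s))).
Proof.
move=> H per s s0; have s0' : - s != 0 by rewrite oppr_eq0.
have [_ _ d1] := dbar_integ H per s0; have [_ _ d2] := dbar_integ H per s0'.
have d3 : der (fun s => integ L (A (- s))) s (integ L (E (- s)) * -1).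
  exact: (@is_derive1_comp R (fun s => integ L (A s)) -%R s _ _ d2
    (is_deriveN (is_derive_id (s : R^o) 1))).
have := is_deriveB d1 d3; by rewrite mulrN1 opprK.
Qed.

Lemma K_per s : KP ka s L = KP ka s (- L) /\ KQ ka s L = KQ ka s (- L).
Proof. by apply: K_periodic; rewrite mulrN kaL ?cosN// sinN sinpi oppr0. Qed.

Let K_dbar : dbar nz (KP ka) (KQ ka) (fun _ _ => 0) (fun _ _ => 0).
Proof. exact/dbar_hol/hol_K. Qed.

Let cKP s : s != 0 -> continuous (KP ka s).
Proof.
by move=> s0; have [//] := dbar_integ K_dbar (fun s _ => (K_per s).2) s0.
Qed.

Lemma continuous_poisson s : s != 0 -> continuous (poisson ka s).
Proof.
by move=> s0 t; apply: cvgB; [exact: cKP|apply: cKP; rewrite oppr_eq0].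
Qed.

Let small (e : R) : 0 < e -> exists2 S : R, 0 < S & forall s, S <= s -> expR (- ka * s) <= e.
Proof.
move=> e0; exists (ka * e)^-1; first by rewrite invr_gt0 mulr_gt0.
move=> s Ss; have s0 : 0 < s by apply: lt_le_trans Ss; rewrite invr_gt0 mulr_gt0.
rewrite mulNr expRN invf_ple ?posrE ?expR_gt0//.
apply: le_trans (expR_ge1Dx _); apply: ler_wpDl => //.
rewrite -(@ler_pM2l _ ka) // in Ss.
by apply: le_trans Ss; rewrite invfM mulrA divff ?gt_eqF// mul1r.
Qed.

(** The integral is a jump of the kernel itself, hence independent of [s > 0] by Cauchy's theorem,
    and the integrand tends uniformly to [1] as [s] grows. *)
Lemma integ_poisson s : 0 < s -> integ L (poisson ka s) = 2 * L.
Proof.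
move=> s0; have L20 : 0 < 2 * L by rewrite mulr_gt0.
have W x : x != 0 -> integ L (poisson ka x) = jump (KP ka) x.
  by move=> x0; rewrite /jump -integB//; apply: cKP; rewrite ?oppr_eq0.
have cst S : s <= S -> jump (KP ka) S = jump (KP ka) s.
  move=> sS; apply/eqP; rewrite -subr_eq0 -normr_le0.
  have -> : 0 = (fun=> 0 : R) S - (fun=> 0 : R) s by rewrite subrr.
  apply: (le_of_derive (f := jump (KP ka)) (g := fun=> 0) (df := fun=> 0) (dg := fun=> 0) sS) => x.
  - move=> /andP[sx _]; have x0 : x != 0 by rewrite gt_eqF// (lt_le_trans s0).
    have := is_derive_jump K_dbar (fun s _ => (K_per s).2) x0.
    by rewrite !integ_cst// !mul0r addr0.
  - by rewrite normr0.
apply/eqP; rewrite -subr_eq0 -normr_le0; apply/ler_addgt0Pr => e e0; rewrite add0r.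
have [S1 S10 HS1] := small (e := 2^-1) (ltac:(by [])).
have [|S2 S20 HS2] := small (e := e / (16 * (2 * L))); first by rewrite divr_gt0 ?mulr_gt0.
(* Past [S1] the bounds of [K_far] hold, and past [S2] they make the integrand differ from [1] by at
   most [e / (2 * L)]. *)
pose S := s + S1 + S2.
have S0 : 0 < S by rewrite !addr_gt0.
have S00 : S != 0 by rewrite gt_eqF.
rewrite W ?gt_eqF// -(cst S) -?W//; last by rewrite /S; lra.
have -> : 2 * L = integ L (fun=> 1) by rewrite integ_cst// mul1r.
rewrite -integB; [|exact: continuous_poisson|by move=> t; exact: cvg_cst].
apply: (@le_trans _ _ (integ L (fun=> e / (2 * L)))); last first.
  by rewrite integ_cst// divfK ?gt_eqF.
apply: integ_norm_le => //.
- by move=> t; apply: cvgB; [exact: continuous_poisson|exact: cvg_cst].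
- by move=> t; exact: cvg_cst.
move=> t _; have [|_ _ _ _] := @K_far _ ka ka0 S t S0; first by apply: HS1; rewrite /S; lra.
move=> /le_trans; apply.
have : expR (- ka * S) <= e / (16 * (2 * L)) by apply: HS2; rewrite /S; lra.
rewrite -(@ler_pM2l _ 16)// => /le_trans; apply.
by rewrite le_eqVlt; apply/orP; left; apply/eqP; field; rewrite gt_eqF.
Qed.


Lemma decay_ge0 s : 0 <= decay s. Proof. exact: powR_ge0. Qed.

Let Cgap := Num.sqrt ((1 + 2 * ka) / (2 * ka)).
(** [8 L] counts a mass [4 L] for each of the lines at [s] and [- s], [Cgap] comes from [gapV_le],
    and [1 / eta] is the integral of [(1 + sqrt s) / sqrt s * decay s] over the positive
    half-line. *)
Let c0 := 8 * L * Cgap / eta.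

Let Cgap0 : 0 < Cgap.
Proof.
rewrite /Cgap sqrtr_gt0; have k2 : 0 < 2 * ka by rewrite pmulr_rgt0.
by rewrite divr_gt0// addr_gt0.
Qed.

Let c00 : 0 < c0.
Proof. by rewrite /c0; apply: divr_gt0 => //; rewrite !mulr_gt0. Qed.

(** An increasing function with values between [- c0] and [0]; comparison with it bounds an improper
    integral in [s] by [c0]. *)
Let prim (s : R) : R := - c0 * (1 + Num.sqrt s) `^ (- (2 * eta)).

Let is_derive_prim s : 0 < s ->
  der prim s (c0 * eta * ((1 + Num.sqrt s) / Num.sqrt s) * decay s).
Proof.
move=> s0; have q0 : 0 < Num.sqrt s by rewrite sqrtr_gt0.
have q1 : 0 < 1 + Num.sqrt s by rewrite addr_gt0.
have d1 : der (fun s => 1 + Num.sqrt s) s (2 * Num.sqrt s)^-1.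
  have := is_deriveD (is_derive_cst (1 : R^o) (s : R^o) 1) (is_derive1_sqrt s0).
  by rewrite add0r.
have d2 := @is_derive1_comp R (@powR R ^~ (- (2 * eta))) (fun s => 1 + Num.sqrt s) s _ _
    (is_derive1_powR (- (2 * eta)) q1) d1.
have := is_deriveM (is_derive_cst (- c0) (s : R^o) 1) d2.
move=> /is_derive_eq; apply; rewrite /GRing.scale/= mulr0 addr0 /decay.
have -> : - (2 + 2 * eta) = - (2 * eta) - 1 - 1 by ring.
rewrite [in RHS]powRB ?(gt_eqF q1) ?implybT// powRr1 ?ltW//.
by field; rewrite !gt_eqF.
Qed.

Let integ_poisson1 s (c : R) : 0 < s -> integ L (fun t => c * (poisson ka s t + 1)) = c * (4 * L).
Proof.
move=> s0; have cp : continuous (poisson ka s) by apply: continuous_poisson; rewrite gt_eqF.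
rewrite integZ//; last by move=> t; apply: cvgD; [exact: cp|exact: cvg_cst].
rewrite integD//; last by move=> t; exact: cvg_cst.
by rewrite integ_poisson// integ_cst//; congr (_ * _); ring.
Qed.

Let continuous_poisson1 s (c : R) : 0 < s -> continuous (fun t => c * (poisson ka s t + 1)).
Proof.
move=> s0 t; apply: cvgM; first exact: cvg_cst.
by apply: cvgD; [apply: continuous_poisson; rewrite gt_eqF|exact: cvg_cst].
Qed.

(** * A bound at the pole for solutions of the inhomogeneous equation *)

Section Estimate.
Variables (x y e1 e2 : R -> R -> R) (m : R).
Hypotheses (m0 : 0 <= m) (xy : dbar setT x y e1 e2).
Hypotheses (xper : forall s, x s L = x s (- L)) (yper : forall s, y s L = y s (- L)).
Hypothesis (e_pos : forall s t, 0 < s -> `|e1 s t| <= m * decay s /\ `|e2 s t| <= m * decay s).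
Hypothesis (e_neg : forall s t, 0 < s ->
  `|e1 (- s) t| <= m * decay s * expR (ka * s) /\ `|e2 (- s) t| <= m * decay s * expR (ka * s)).
Hypothesis (xy_far : forall e : R, 0 < e -> exists S : R, forall s t, S <= s ->
  [/\ `|x s t| <= e, `|y s t| <= e, `|x (- s) t| <= e * expR (ka * s) &
      `|y (- s) t| <= e * expR (ka * s)]).

Let A s t := KP ka s t * x s t - KQ ka s t * y s t.
Let C s t := KP ka s t * y s t + KQ ka s t * x s t.
Let E s t := KP ka s t * e1 s t - KQ ka s t * e2 s t.

Let A_dbar : dbar nz A C E (fun s t => KP ka s t * e2 s t + KQ ka s t * e1 s t).
Proof. by apply: dbar_holM; [exact: hol_K|exact: dbar_sub xy]. Qed.

Let C_per (s : R) : s != 0 -> C s L = C s (- L).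
Proof. by rewrite /C (K_per s).1 (K_per s).2 xper yper. Qed.

Let cA s : s != 0 -> continuous (A s).
Proof. by move=> s0; have [] := dbar_integ A_dbar C_per s0. Qed.

Let cE s : s != 0 -> continuous (E s).
Proof. by move=> s0; have [] := dbar_integ A_dbar C_per s0. Qed.

Let K_prod (k1 k2 z1 z2 a b : R) : `|k1| <= a -> `|k2| <= a -> `|z1| <= b -> `|z2| <= b ->
  `|k1 * z1 - k2 * z2| <= 2 * (a * b).
Proof.
move=> h1 h2 h3 h4; rewrite (le_trans (ler_normB _ _))// !normrM.
have := ler_pM (normr_ge0 _) (normr_ge0 _) h1 h3.
have := ler_pM (normr_ge0 _) (normr_ge0 _) h2 h4; lra.
Qed.

Let rV s : expR (- ka * s) * expR (ka * s) = 1.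
Proof. by rewrite -expRD mulNr addNr expR0. Qed.

(** The kernel contributes [(poisson + 1) / (2 gap)], whose integral is known; on the line at [- s]
    the factors [exp (- ka s)] and [exp (ka s)] cancel. *)
Let E_le s : 0 < s -> `|integ L (E s)| <= m * decay s / gap ka s * (4 * L) /\
  `|integ L (E (- s))| <= m * decay s / gap ka s * (4 * L).
Proof.
move=> s0; have g0 := gap_gt0 ka0 s0.
rewrite -(integ_poisson1 _ s0); split; apply: integ_norm_le => //.
- by apply: cE; rewrite gt_eqF.
- exact: continuous_poisson1.
- move=> t _; have [k1 k2] := K_le ka0 t s0; have [h1 h2] := e_pos t s0.
  rewrite (le_trans (K_prod k1 k2 h1 h2))// le_eqVlt; apply/orP; left; apply/eqP.
  by field; rewrite gt_eqF.
- by apply: cE; rewrite oppr_eq0 gt_eqF.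
- exact: continuous_poisson1.
- move=> t _; have [k1 k2] := KN_le ka0 t s0; have [h1 h2] := e_neg t s0.
  rewrite (le_trans (K_prod k1 k2 h1 h2))// le_eqVlt; apply/orP; left; apply/eqP.
  transitivity (m * decay s / gap ka s * (poisson ka s t + 1) *
    (expR (- ka * s) * expR (ka * s))); last by rewrite rV mulr1.
  by field; rewrite gt_eqF.
Qed.

(** By [E_le] and [gapV_le] the derivative of the jump is dominated by that of [m * prim]. *)
Let jump_le s1 s2 : 0 < s1 -> s1 <= s2 -> jump A s1 <= jump A s2 + c0 * m.
Proof.
move=> s10 s12.
have der_prim (s : R) : s1 <= s <= s2 -> der (fun s => m * prim s) s
    (m * (c0 * eta * ((1 + Num.sqrt s) / Num.sqrt s) * decay s)).
  move=> /andP[s1s _]; have s0 : 0 < s by apply: lt_le_trans s1s.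
  have := is_deriveM (is_derive_cst m (s : R^o) 1) (is_derive_prim s0).
  by move=> /is_derive_eq; apply; rewrite /GRing.scale/= mulr0 addr0.
have H := @le_of_derive R (jump A) (fun s => m * prim s)
  (fun s => integ L (E s) + integ L (E (- s))) _ s1 s2 s12 _ der_prim _.
have {}H : `|jump A s2 - jump A s1| <= m * prim s2 - m * prim s1.
  apply: H => s /andP[s1s _]; have s0 : 0 < s by apply: lt_le_trans s1s.
    by apply: (is_derive_jump A_dbar C_per); rewrite gt_eqF.
  have [h1 h2] := E_le s0; rewrite (le_trans (ler_normD _ _))//.
  apply: (le_trans (lerD h1 h2)).
  have -> : c0 * eta = 8 * L * Cgap by rewrite /c0 divfK// gt_eqF.
  have := gapV_le ka0 s0; rewrite -/Cgap => gV.
  have : m * decay s * (8 * L) * (gap ka s)^-1 <=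
     m * decay s * (8 * L) * (Cgap * ((1 + Num.sqrt s) / Num.sqrt s)).
    by apply: ler_wpM2l gV; rewrite !mulr_ge0 ?decay_ge0// ltW.
  lra.
have p1 : - c0 <= prim s1.
  rewrite /prim mulNr lerN2; apply: ler_piMr; first exact: ltW.
  rewrite -[leRHS](powRr0 (1 + Num.sqrt s1)).
  apply: ler_powR; first by rewrite lerDl sqrtr_ge0.
  by rewrite oppr_le0 mulr_ge0// ltW.
have p2 : prim s2 <= 0 by rewrite /prim mulNr oppr_le0 mulr_ge0 ?powR_ge0// ltW.
have := ler_wpM2l m0 p1; have := mulr_ge0_le0 m0 p2.
move: H; rewrite ler_norml; lra.
Qed.

Let jump_far (e : R) : 0 < e -> exists2 S : R, 0 < S & forall s, S <= s -> jump A s <= e.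
Proof.
move=> e0; have LL : 0 < 16 * L by rewrite mulr_gt0.
(* With this choice each of the two lines contributes at most [e / (4 * L)] to the integrand, and
   the interval has length [2 * L]. *)
have [|S1 HS1] := xy_far (e := e / (16 * L)); first by rewrite divr_gt0.
have [S2 S20 HS2] := small (e := 2^-1) (ltac:(by [])).
exists (S2 + `|S1|); first by rewrite ltr_pwDl.
move=> s Ss; have s0 : 0 < s by apply: lt_le_trans Ss; rewrite ltr_pwDl.
have s0' : s != 0 by rewrite gt_eqF.
have s0'' : - s != 0 by rewrite oppr_eq0.
have s1 : S1 <= s by have := ler_norm S1; lra.
have s2 : S2 <= s by have := normr_ge0 S1; lra.
rewrite /jump -integB; [|exact: cA|exact: cA].
apply: le_trans (ler_norm _) _.
have -> : e = integ L (fun=> e / (2 * L)) by rewrite integ_cst// divfK// gt_eqF// mulr_gt0.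
apply: integ_norm_le => //.
- by move=> t; apply: cvgB; exact: cA.
- by move=> t; exact: cvg_cst.
move=> t _; have [k1 k2 k3 k4 _] := K_far ka0 t s0 (HS2 _ s2).
have [x1 y1 x2 y2] := HS1 _ t s1.
have h1 := K_prod k1 k2 x1 y1; have h2 := K_prod k3 k4 x2 y2.
have e16 : e / (16 * L) = e / (2 * L) / 8 by field; rewrite gt_eqF.
rewrite (le_trans (ler_normB _ _))// (le_trans (lerD h1 h2))// e16.
set w := e / (2 * L).
have -> : 2 * (2 * expR (- ka * s) * (w / 8 * expR (ka * s))) =
  w / 2 * (expR (- ka * s) * expR (ka * s)) by field.
rewrite rV; lra.
Qed.

(** As [s] tends to [0], the Poisson part of the jump concentrates at [t = 0] and yields
    [2 L x(0, 0)]. The rest pairs the kernel, whose integral is [O(1 / gap)], with differences of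
    size [O(s)]; since [gap] is of order [sqrt s], so is the error. *)
Let jump_near : exists2 c : R, 0 < c &
  forall s, 0 < s <= 1 -> 2 * L * x 0 0 - c * Num.sqrt s <= jump A s.
Proof.
have [[xs xt] /= Cx [[ys yt] /= Cy _]] := xy.
have [M1 M10 HM1] := C1_lipschitz L0 Cx; have [M2 M20 HM2] := C1_lipschitz L0 Cy.
pose M := M1 + M2.
pose K3 := Num.sqrt (4 * expR ka / ka ^+ 2).
(* The three terms absorb the error from moving [x] in [s], the first moment of the Poisson kernel,
   and the kernel against the differences of [x] and [y]. *)
pose om := 1 + K3 / 2 * Num.sqrt (2 * ka) + 4 * Cgap.
have om0 : 0 < om.
  have h1 : 0 <= K3 / 2 * Num.sqrt (2 * ka).
    by rewrite mulr_ge0 ?sqrtr_ge0// divr_ge0// sqrtr_ge0.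
  by rewrite /om; have := Cgap0; lra.
have M0 : 0 < M by rewrite addr_gt0.
exists (M * om * (4 * L)); first by apply: mulr_gt0; apply: mulr_gt0.
move=> s /andP[s0 s1]; have s0' : s != 0 by rewrite gt_eqF.
have s0'' : - s != 0 by rewrite oppr_eq0.
have q0 : 0 < Num.sqrt s by rewrite sqrtr_gt0.
have q1 : Num.sqrt s <= 1 by rewrite -sqrtr1 ler_wsqrtr.
have sq : s = Num.sqrt s * Num.sqrt s by rewrite -expr2 sqr_sqrtr// ltW.
rewrite /jump -integB; [|exact: cA|exact: cA].
have -> : 2 * L * x 0 0 - M * om * (4 * L) * Num.sqrt s =
  integ L (fun t => x 0 0 * poisson ka s t - M * om * Num.sqrt s * (poisson ka s t + 1)).
  rewrite integB; last 2 first.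
  - by move=> t; apply: cvgM; [exact: cvg_cst|exact: continuous_poisson].
  - exact: continuous_poisson1.
  rewrite integ_poisson1// integZ//; last exact: continuous_poisson.
  by rewrite integ_poisson//; ring.
apply: le_integ => //.
- move=> t; apply: cvgB; last exact: continuous_poisson1.
  by apply: cvgM; [exact: cvg_cst|exact: continuous_poisson].
- by move=> t; apply: cvgB; exact: cA.
move=> t tL; have tL' : `|t| <= L by rewrite ler_norml.
have ns : `|s| <= 1 by rewrite ger0_norm// ltW.
have nNs : `|- s| <= 1 by rewrite normrN.
have n0 : `|0 : R| <= 1 by rewrite normr0.
have p0 := poisson_ge0 ka0 t s0.
have g0 := gap_gt0 ka0 s0.
have [k1 k2] := K_le ka0 t s0.
set P := poisson ka s t in p0 k1 k2 *.
(* Because [KQ] agrees at [s] and [- s], only the Poisson kernel multiplies a term that is not a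
   difference across [s = 0]. *)
have -> : A s t - A (- s) t = P * x (- s) t +
   (KP ka s t * (x s t - x (- s) t) - KQ ka s t * (y s t - y (- s) t)).
  by rewrite /A /P /poisson KQN_eq//; ring.
have ss : `|s - - s| = 2 * s by rewrite opprK ger0_norm ?addr_ge0 ?ltW//; ring.
have M1M : M1 <= M by rewrite lerDl ltW.
have M2M : M2 <= M by rewrite lerDr ltW.
have dx : `|x s t - x (- s) t| <= M * (2 * s).
  have [h _] := HM1 s (- s) t ns nNs tL'; rewrite ss in h; apply: le_trans h _.
  by apply: ler_wpM2r M1M; rewrite mulr_ge0// ltW.
have dy : `|y s t - y (- s) t| <= M * (2 * s).
  have [h _] := HM2 s (- s) t ns nNs tL'; rewrite ss in h; apply: le_trans h _.
  by apply: ler_wpM2r M2M; rewrite mulr_ge0// ltW.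
have d0 : `|x (- s) t - x 0 0| <= M * (s + `|t|).
  have -> : x (- s) t - x 0 0 = (x (- s) t - x (- s) 0) + (x (- s) 0 - x 0 0) by ring.
  have [_ h1] := HM1 (- s) s t nNs ns tL'.
  have L0' : `|0 : R| <= L by rewrite normr0 ltW.
  have [h2 _] := HM1 (- s) 0 0 nNs n0 L0'.
  rewrite subr0 normrN (gtr0_norm s0) in h2.
  rewrite (le_trans (ler_normD _ _))// (le_trans (lerD h1 h2))// -mulrDr addrC.
  by apply: ler_wpM2r M1M; rewrite addr_ge0// ltW.
have Pt : P * `|t| <= K3 * (gap ka s / 2) * (1 + P).
  apply: (poisson_norm_le ka0); first by rewrite s0.
  by rewrite normrM (gtr0_norm ka0) -kaL ler_wpM2l// ltW.
have t1 : P * x 0 0 - M * (P * s + K3 * (gap ka s / 2) * (1 + P)) <= P * x (- s) t.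
  have h1 : x 0 0 - M * (s + `|t|) <= x (- s) t by move: d0; rewrite ler_norml; lra.
  apply: le_trans (ler_wpM2l p0 h1).
  have := ler_wpM2l (addr_ge0 (ltW M10) (ltW M20)) Pt; rewrite -/M; lra.
have t2 := K_prod k1 k2 dx dy; move: t2; rewrite ler_norml => /andP[t2 _].
have gg : s / gap ka s <= Num.sqrt s * (2 * Cgap).
  have := ler_wpM2l (ltW s0) (gapV_le ka0 s0) => /le_trans; apply.
  rewrite -/Cgap {1}sq.
  have -> : Num.sqrt s * Num.sqrt s * (Cgap * ((1 + Num.sqrt s) / Num.sqrt s)) =
    Num.sqrt s * ((1 + Num.sqrt s) * Cgap) by field; rewrite gt_eqF.
  rewrite ler_pM2l// ler_wpM2r// ?(ltW Cgap0)//; lra.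
have gl := gap_le ka0 s0.
have MP : 0 <= M * (P + 1) by apply: mulr_ge0; [exact: ltW|rewrite addr_ge0].
have b1 : M * (P + 1) * s <= M * (P + 1) * Num.sqrt s.
  apply: ler_wpM2l => //.
  by rewrite {1}sq ler_piMr// ltW.
have b2 : M * (P + 1) * (K3 / 2) * gap ka s <=
    M * (P + 1) * (K3 / 2) * (Num.sqrt (2 * ka) * Num.sqrt s).
  by apply: ler_wpM2l gl; apply: mulr_ge0 => //; rewrite divr_ge0// sqrtr_ge0.
have b3 : M * (P + 1) * 2 * (s / gap ka s) <= M * (P + 1) * 2 * (Num.sqrt s * (2 * Cgap)).
  by apply: ler_wpM2l gg; apply: mulr_ge0.
have b4 : M * P * s <= M * (P + 1) * s.
  by apply: ler_wpM2r; [exact: ltW|apply: ler_wpM2l; [exact: ltW|rewrite lerDl]].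
have e3 : 2 * ((P + 1) / (2 * gap ka s) * (M * (2 * s))) = M * (P + 1) * 2 * (s / gap ka s).
  by field; rewrite gt_eqF.
rewrite e3 in t2.
have e4 : M * om * Num.sqrt s * (P + 1) = M * (P + 1) * Num.sqrt s +
  M * (P + 1) * (K3 / 2) * (Num.sqrt (2 * ka) * Num.sqrt s) +
  M * (P + 1) * 2 * (Num.sqrt s * (2 * Cgap)) by rewrite /om; ring.
rewrite e4; lra.
Qed.

(** Up to vanishing errors, the left-hand side is at most the jump near [s = 0], which exceeds the
    jump far out by at most [c0 * m], and the latter is at most [0]. *)
Lemma cylinder_estimate : 2 * L * x 0 0 <= c0 * m.
Proof.
have [c cp near0] := jump_near.
apply/ler_addgt0Pr => e e0.
have [S S0 HS] := jump_far (e := e / 2) (ltac:(lra)).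
(* [q] is the square root of the small [s], chosen to make the error [c * sqrt s] at most
   [e / 2]. *)
pose q := Num.min 1 (e / (2 * c)).
have q0 : 0 < q by rewrite lt_min ltr01 divr_gt0 ?mulr_gt0.
pose s := q ^+ 2; have s0 : 0 < s by rewrite exprn_gt0.
have s1 : s <= 1 by rewrite expr_le1 ?(ltW q0)// ge_min lexx.
have qs : Num.sqrt s = q by rewrite sqrtr_sqr gtr0_norm.
have := near0 s; rewrite s0 s1 qs => /(_ isT).
have : c * q <= e / 2.
  have : q <= e / (2 * c) by rewrite ge_min lexx orbT.
  rewrite -(ler_pM2l cp) => /le_trans; apply.
  by rewrite le_eqVlt; apply/orP; left; apply/eqP; field; rewrite gt_eqF.
have sS : s <= S + s by rewrite lerDr ltW.
have := jump_le s0 sS; have : jump A (S + s) <= e / 2 by apply: HS; rewrite lerDl ltW.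
lra.
Qed.

End Estimate.
End Cylinder.

(** * The estimate for a finite sum of Fourier modes *)

Section Modes.
Variables (R : realType) (L eta : R).
Hypotheses (L0 : 0 < L) (eta0 : 0 < eta).
Local Notation ka := (pi / L).

(** Cauchy-Schwarz in the additive form of AM-GM, with weight [nu = tau / (D * b)], so that it can
    be summed over modes; [tau] stays free. In the application [p + i q] is
    [a conj(w(0)) exp (- mu z)], [n] is [|w(0)| ^ 2], and [f + i g] is the right-hand side of the
    equation. *)
Lemma weighted_amgm (p q f g r a b n D tau : R) : 0 < b -> 0 < D -> 0 < tau -> 0 <= n ->
  0 <= a -> p ^+ 2 + q ^+ 2 = r ^+ 2 * (a ^+ 2 * n) -> a * r ^+ 2 <= D ^+ 2 * b ->
  `|p * f - q * g| <= D / 2 * (tau * (a * n) + b * (f ^+ 2 + g ^+ 2) / tau).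
Proof.
move=> b0 D0 tau0 n0 a0 pq ar.
pose nu := tau / (D * b).
have nu0 : 0 < nu by rewrite divr_gt0 ?mulr_gt0.
have h1 : `|p * f - q * g| <= (nu * (p ^+ 2 + q ^+ 2) + (f ^+ 2 + g ^+ 2) / nu) / 2.
  have -> : (nu * (p ^+ 2 + q ^+ 2) + (f ^+ 2 + g ^+ 2) / nu) / 2 =
    ((nu * p) ^+ 2 + (nu * q) ^+ 2 + f ^+ 2 + g ^+ 2) / (2 * nu).
    by field; rewrite gt_eqF.
  have nu2 : 0 < 2 * nu by rewrite mulr_gt0.
  rewrite ler_pdivlMr// -[X in _ * X <= _](gtr0_norm nu2) -normrM ler_norml.
  have := sqr_ge0 (nu * p - f); have := sqr_ge0 (nu * q + g).
  have := sqr_ge0 (nu * p + f); have := sqr_ge0 (nu * q - g).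
  by move=> *; apply/andP; split; lra.
apply: le_trans h1 _; rewrite pq.
have h2 : nu * (r ^+ 2 * (a ^+ 2 * n)) <= D * (tau * (a * n)).
  have -> : nu * (r ^+ 2 * (a ^+ 2 * n)) = (tau * (a * n) / (D * b)) * (a * r ^+ 2).
    by rewrite /nu; field; rewrite !gt_eqF.
  have -> : D * (tau * (a * n)) = (tau * (a * n) / (D * b)) * (D ^+ 2 * b).
    by field; rewrite !gt_eqF.
  apply: ler_wpM2l ar; apply: divr_ge0; first by rewrite !mulr_ge0// ltW.
  by rewrite mulr_ge0// ltW.
have -> : (f ^+ 2 + g ^+ 2) / nu = D * (b * (f ^+ 2 + g ^+ 2) / tau).
  by rewrite /nu; field; rewrite !gt_eqF.
lra.
Qed.

Variables (I : Type) (X : seq I) (mu a b : I -> R) (x y f g : I -> R -> R -> R) (m G : R).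
Hypotheses (m0 : 0 < m) (a0 : forall i, 0 <= a i) (b0 : forall i, 0 < b i).
Hypotheses (mu0 : forall i, 0 <= mu i) (muka : forall i, mu i <= ka).
Hypothesis xy : forall i, dbar setT (x i) (y i) (f i) (g i).
Hypothesis x_twist : forall i s, x i s L =
  cos (2 * (mu i * L)) * x i s (- L) - sin (2 * (mu i * L)) * y i s (- L).
Hypothesis y_twist : forall i s, y i s L =
  sin (2 * (mu i * L)) * x i s (- L) + cos (2 * (mu i * L)) * y i s (- L).
Hypothesis fg : forall s t, \sum_(i <- X) b i * (f i s t ^+ 2 + g i s t ^+ 2) <= G.
Hypothesis decay_pos : forall i s, 0 < s ->
  a i * expR (- mu i * s) ^+ 2 <= (m * decay eta s) ^+ 2 * b i.
Hypothesis decay_neg : forall i s, 0 < s ->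
  a i * expR (mu i * s) ^+ 2 <= (m * decay eta s * expR (ka * s)) ^+ 2 * b i.
Hypothesis far : forall e : R, 0 < e -> exists S : R, forall i s t, S <= `|s| ->
  `|x i s t| <= e /\ `|y i s t| <= e.

(** [al + i be] is [a_i] times the conjugate of [w_i(0)]. The [a] here is the square of the weight
    written [a_n] in the overview. *)
Let al i := a i * x i 0 0.
Let be i := - (a i * y i 0 0).
Let p i := expp (mu i) (al i) (be i).
Let q i := expq (mu i) (al i) (be i).

Let S := \sum_(i <- X) a i * (x i 0 0 ^+ 2 + y i 0 0 ^+ 2).

Let pq_sq i s t : p i s t ^+ 2 + q i s t ^+ 2 =
  expR (- mu i * s) ^+ 2 * (a i ^+ 2 * (x i 0 0 ^+ 2 + y i 0 0 ^+ 2)).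
Proof. by rewrite expp_sqD /al /be; congr (_ * _); ring. Qed.

Let pq_le i s t : `|p i s t| <= expR (- mu i * s) * (`|al i| + `|be i|) /\
  `|q i s t| <= expR (- mu i * s) * (`|al i| + `|be i|).
Proof.
have H (u v : R) : `|u| <= 1 -> `|v| <= 1 -> `|al i * u + be i * v| <= `|al i| + `|be i|.
  move=> u1 v1; rewrite (le_trans (ler_normD _ _))// !normrM.
  by apply: lerD; apply: ler_piMr.
rewrite /p /q /expp /expq !(normrM (expR _)) !(gtr0_norm (expR_gt0 _)).
split; apply: ler_wpM2l => //; first by apply: H; rewrite ?cos_max ?sin_max.
rewrite (_ : be i * _ - _ = al i * - sin (mu i * t) + be i * cos (mu i * t)); last by ring.
by apply: H; rewrite ?normrN ?cos_max ?sin_max.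
Qed.

(** Over one period [w_i] picks up the factor [exp (2 i mu L)] and [exp (- mu z)] its inverse, so
    that their product is periodic. *)
Let twist i s :
  p i s L * x i s L - q i s L * y i s L = p i s (- L) * x i s (- L) - q i s (- L) * y i s (- L) /\
  p i s L * y i s L + q i s L * x i s L = p i s (- L) * y i s (- L) + q i s (- L) * x i s (- L).
Proof.
have e := cos2Dsin2 (mu i * L).
have c2 : cos (2 * (mu i * L)) = cos (mu i * L) ^+ 2 - sin (mu i * L) ^+ 2.
  by rewrite mulr_natl mulr2n cosD.
have s2 : sin (2 * (mu i * L)) = 2 * cos (mu i * L) * sin (mu i * L).
  by rewrite mulr_natl mulr2n sinD; ring.
rewrite x_twist y_twist c2 s2 /p /q /expp /expq !mulrN !cosN !sinN.
move: e; set c := cos _; set d := sin _; set E := expR _ => e.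
set u := x i s _; set v := y i s _; set A := al i; set B := be i.
(* Multiplying the right-hand side by [c ^ 2 + d ^ 2 = 1] makes both sides homogeneous of the same
   degree in [c] and [d]. *)
split; rewrite -[RHS]mul1r -[X in _ = X * _]e; ring.
Qed.

Let sum_le (tau D s t : R) : 0 < tau -> 0 < D ->
  (forall i, a i * expR (- mu i * s) ^+ 2 <= D ^+ 2 * b i) ->
  `|\sum_(i <- X) (p i s t * f i s t - q i s t * g i s t)| <= D / 2 * (tau * S + G / tau) /\
  `|\sum_(i <- X) (p i s t * g i s t + q i s t * f i s t)| <= D / 2 * (tau * S + G / tau).
Proof.
move=> tau0 D0 H.
have D2 : 0 <= D / 2 by rewrite divr_ge0// ltW.
have n0 i : 0 <= x i 0 0 ^+ 2 + y i 0 0 ^+ 2 by rewrite addr_ge0 ?sqr_ge0.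
have K : \sum_(i <- X) D / 2 * (tau * (a i * (x i 0 0 ^+ 2 + y i 0 0 ^+ 2)) +
      b i * (f i s t ^+ 2 + g i s t ^+ 2) / tau) <= D / 2 * (tau * S + G / tau).
  rewrite -mulr_sumr; apply: ler_wpM2l => //.
  rewrite big_split/= -mulr_sumr -mulr_suml lerD2l.
  by rewrite ler_pM2r ?invr_gt0.
split; (apply: le_trans (ler_norm_sum _ _ _) _; apply: le_trans K; apply: ler_sum => i _).
  exact: (weighted_amgm _ _ (b0 i) D0 tau0 (n0 i) (a0 i) (pq_sq i s t) (H i)).
rewrite (_ : _ + _ = p i s t * g i s t - (- q i s t) * f i s t); last by ring.
rewrite (addrC (f i s t ^+ 2)).
apply: (weighted_amgm _ _ (b0 i) D0 tau0 (n0 i) (a0 i) _ (H i)).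
by rewrite sqrrN pq_sq.
Qed.

(** The cylinder estimate is applied to [Psi], whose value at [0] is [S] itself. The bound is affine
    in [S] with an absorbable coefficient, and the number of modes enters the result only through
    [G]. *)
Lemma modes_estimate :
  S <= (8 * L * Num.sqrt ((1 + 2 * ka) / (2 * ka)) / eta * m) ^+ 2 * G / (4 * L ^+ 2).
Proof.
set c := _ * _ / eta.
have ka0 : 0 < ka by rewrite divr_gt0// pi_gt0.
have c0 : 0 < c.
  rewrite /c; apply: divr_gt0 => //; apply: mulr_gt0; first by rewrite mulr_gt0.
  by rewrite sqrtr_gt0; apply: divr_gt0; rewrite ?addr_gt0// mulr_gt0.
(* this [tau] lets half of the left-hand side absorb the [S] produced by AM-GM *)
pose tau := 2 * L / (c * m).
have tau0 : 0 < tau by apply: divr_gt0; rewrite mulr_gt0.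
pose Psx s t := \sum_(i <- X) (p i s t * x i s t - q i s t * y i s t).
pose Psy s t := \sum_(i <- X) (p i s t * y i s t + q i s t * x i s t).
have Ps_dbar := dbar_sum X (fun i => dbar_holM (hol_exp setT (mu i) (al i) (be i)) (xy i)).
have decay0 s : 0 < decay eta s by rewrite powR_gt0// ltr_pwDl// sqrtr_ge0.
have S0 : 0 <= S.
  by apply: sumr_ge0 => i _; rewrite mulr_ge0// addr_ge0 ?sqr_ge0.
have G0 : 0 <= G.
  apply: le_trans (fg 0 0); apply: sumr_ge0 => i _.
  by rewrite mulr_ge0 ?addr_ge0 ?sqr_ge0// ltW.
pose w := (tau * S + G / tau) / 2.
have w0 : 0 <= w.
  apply: divr_ge0 => //; apply: addr_ge0; first by rewrite mulr_ge0// ltW.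
  by rewrite divr_ge0// ltW.
have := @cylinder_estimate R L eta L0 eta0 Psx Psy _ _ (m * w) _ Ps_dbar _ _ _ _ _.
have -> : Psx 0 0 = S.
  apply: eq_bigr => i _; rewrite /p /q /expp /expq !mulr0 expR0 cos0 sin0 /al /be; ring.
move=> H.
have {}H : 2 * L * S <= c * (m * w).
  apply: H.
  - by rewrite mulr_ge0// ltW.
  - by move=> s; apply: eq_bigr => i _; have [] := twist i s.
  - by move=> s; apply: eq_bigr => i _; have [] := twist i s.
  - move=> s t s0; have D0 : 0 < m * decay eta s by rewrite mulr_gt0.
    have [h1 h2] := sum_le t tau0 D0 (fun i => decay_pos i s0).
    have e : m * w * decay eta s = m * decay eta s / 2 * (tau * S + G / tau) by rewrite /w; ring.
    by rewrite e.
  - move=> s t s0.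
    have D0 : 0 < m * decay eta s * expR (ka * s) by rewrite !mulr_gt0 ?expR_gt0.
    have [|h1 h2] := sum_le (s := - s) t tau0 D0.
      by move=> i; rewrite mulrNN; exact: decay_neg.
    have e : m * w * decay eta s * expR (ka * s) =
      m * decay eta s * expR (ka * s) / 2 * (tau * S + G / tau) by rewrite /w; ring.
    by rewrite e.
  - move=> e e0; pose W := \sum_(i <- X) (`|al i| + `|be i|).
    have W0 : 0 <= W by apply: sumr_ge0 => i _; rewrite addr_ge0.
    (* The [1] keeps the divisor positive when every coefficient vanishes. *)
    have W1 : 0 < 2 * W + 1 by rewrite ltr_pwDr// mulr_ge0.
    have [|T HT] := far (e := e / (2 * W + 1)); first by rewrite divr_gt0.
    have We : 2 * W * (e / (2 * W + 1)) <= e.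
      rewrite mulrA ler_pdivrMr// mulrC ler_pM2l//; lra.
    have K s t (z z' : I -> R) r : T <= `|s| -> (forall i, expR (- mu i * s) <= r) -> 0 <= r ->
        (forall i, `|z i| <= e / (2 * W + 1)) -> (forall i, `|z' i| <= e / (2 * W + 1)) ->
        `|\sum_(i <- X) (p i s t * z i + q i s t * z' i)| <= e * r.
      move=> Ts hr r0 hz hz'.
      apply: le_trans (ler_norm_sum _ _ _) _.
      apply: (@le_trans _ _ (2 * W * (e / (2 * W + 1)) * r)); last by rewrite ler_wpM2r.
      move: hz hz'; set d := e / _ => hz hz'.
      rewrite /W mulr_sumr !mulr_suml; apply: ler_sum => i _.
      rewrite (le_trans (ler_normD _ _))// (normrM (p i s t)) (normrM (q i s t)).
      have [h1 h2] := pq_le i s t.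
      have hh (k : R) : `|k| <= expR (- mu i * s) * (`|al i| + `|be i|) ->
          `|k| <= r * (`|al i| + `|be i|).
        by move=> /le_trans; apply; rewrite ler_wpM2r ?addr_ge0.
      have := ler_pM (normr_ge0 _) (normr_ge0 _) (hh _ h1) (hz i).
      have := ler_pM (normr_ge0 _) (normr_ge0 _) (hh _ h2) (hz' i).
      lra.
    exists (Num.max 0 T) => s t Ts.
    have s0 : 0 <= s by apply: le_trans Ts; rewrite le_max lexx.
    have Ts1 : T <= `|s| by rewrite ger0_norm// (le_trans _ Ts)// le_max lexx orbT.
    have Ts2 : T <= `|- s| by rewrite normrN.
    have r1 i : expR (- mu i * s) <= 1 by rewrite -expR0 ler_expR mulNr oppr_le0 mulr_ge0.
    (* [mu i <= ka] limits the growth of [exp (- mu z)] on the negative side to the one that the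
       cylinder estimate allows. *)
    have r2 i : expR (- mu i * - s) <= expR (ka * s) by rewrite ler_expR mulrNN ler_wpM2r.
    split.
    + rewrite -[e]mulr1 /Psx; under eq_bigr do rewrite -mulrN.
      by apply: K => // i; rewrite ?normrN; have [] := HT i s t Ts1.
    + by rewrite -[e]mulr1; apply: K => // i; have [] := HT i s t Ts1.
    + rewrite /Psx; under eq_bigr do rewrite -mulrN.
      by apply: K; rewrite ?expR_ge0// => i; rewrite ?normrN; have [] := HT i (- s) t Ts2.
    + by apply: K; rewrite ?expR_ge0// => i; have [] := HT i (- s) t Ts2.
have cm : 0 < c * m by rewrite mulr_gt0.
have e : c * (m * w) = L * S + (c * m) ^+ 2 * G / (4 * L).
  by rewrite /w /tau; field; rewrite !gt_eqF.
rewrite e in H.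
have H2 : L * S <= (c * m) ^+ 2 * G / (4 * L) by lra.
rewrite -(ler_pM2l L0); apply: le_trans H2 _; rewrite le_eqVlt; apply/orP; left; apply/eqP.
by field; rewrite gt_eqF.
Qed.

End Modes.

(** * Diophantine estimates *)

Section Arithmetic.
Variable R : realType.
Implicit Types (x rho nu : R).

(** Rounding [q x] down approximates [x] within [1 / q] for every positive [q]. An exponent
    [rho < 1] would then give [c q ^ (1 - rho) < 1] for all these [q], which fails for large [q]. *)
Lemma irr_exponents_ge1 x rho : irr_exponents x rho -> 1 <= rho.
Proof.
move=> [c c0 H]; rewrite leNgt; apply/negP => rho1.
pose e := 1 - rho; have e0 : 0 < e by rewrite subr_gt0.
pose y := (c^-1) `^ e^-1; have y0 : 0 <= y by exact: powR_ge0.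
pose q := Num.Def.archi_bound y.
have yq : y < q%:R by exact: archi_boundP.
have q0 : 0 < q%:R :> R by apply: le_lt_trans yq.
have qn : (0 < q)%N by rewrite -(ltr0n R).
have /andP[f1 f2] := floor_itv (q%:R * x); set p := Num.Def.floor _ in f1 f2.
rewrite intrD in f2.
have h := H p q qn.
have h2 : `|x - p%:~R / q%:R| <= q%:R^-1.
  have -> : x - p%:~R / q%:R = (q%:R * x - p%:~R) / q%:R by field; rewrite gt_eqF.
  rewrite normrM normfV (gtr0_norm q0) ler_piMl ?invr_ge0 ?ler0n//.
  by rewrite ger0_norm ?subr_ge0//; lra.
have {h h2} h3 : c * q%:R `^ (- rho) < q%:R^-1 := lt_le_trans h h2.
have h4 : c * q%:R `^ e < 1.
  have -> : q%:R `^ e = q%:R `^ (- rho) * q%:R.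
    by rewrite /e addrC powRD ?(gt_eqF q0) ?implybT// powRr1// ltW.
  by rewrite mulrA -ltr_pdivlMr// div1r.
have : c^-1 <= q%:R `^ e.
  have -> : c^-1 = y `^ e by rewrite /y -powRrM mulVf ?gt_eqF// powRr1// invr_ge0 ltW.
  by apply: ge0_ler_powR; rewrite ?nnegrE ?(ltW e0)// ltW.
rewrite -(ler_pM2l c0) mulfV ?gt_eqF//; lra.
Qed.

Lemma irr_exponents_le x rho rho' : rho <= rho' -> irr_exponents x rho -> irr_exponents x rho'.
Proof.
move=> rr [c c0 H]; exists c => // p q q0; apply: le_lt_trans (H p q q0).
by rewrite ler_pM2l// ler_powR ?ler1n// lerN2.
Qed.

Lemma irr_measure_ge1 x : diophantine x -> 1 <= irr_measure x.
Proof. by move=> [_ n0]; apply: lb_le_inf => // rho /irr_exponents_ge1. Qed.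

(** The infimum need not be attained, hence the slack [e]; half of it moves the exponent strictly
    above [1], which makes [be] in [floer_bound] positive. *)
Lemma irr_measure_approx x (e : R) : diophantine x -> 0 < e ->
  exists2 rho, irr_exponents x rho & 1 < rho < irr_measure x + e.
Proof.
move=> [_ n0] e0; have e2 : 0 < e / 2 by rewrite divr_gt0.
have [|rho rhoE rhol] := @inf_adherent R (irr_exponents x) _ e2.
  by split => //; exists 1 => rho /irr_exponents_ge1.
have := irr_exponents_ge1 rhoE.
exists (rho + e / 2); first by apply: irr_exponents_le rhoE; lra.
by rewrite -/(irr_measure x) in rhol; apply/andP; split; lra.
Qed.

(** The Diophantine inequality for the denominator [|n| ^ d], multiplied by that denominator, whence
    the exponent [d (rho - 1)]. *)
Lemma small_divisor nu rho (d : nat) : irr_exponents nu rho ->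
  exists2 c : R, 0 < c & forall (n : mode) (j : int),
    c * (absz (val n))%:R `^ (- (d%:R * (rho - 1))) <= `|j%:~R - nu * (val n)%:~R ^+ d|.
Proof.
move=> [c c0 H]; exists c => // n j.
pose b : bool := (val n < 0)%R; pose a := absz (val n).
have a0 : (0 < a)%N by rewrite absz_gt0; exact: valP n.
have q0 : (0 < a ^ d)%N by rewrite expn_gt0 a0.
have q0' : 0 < (a ^ d)%:R :> R by rewrite ltr0n.
(* The sign of [n ^ d], moved onto [j] because the denominators in [irr_exponents] are positive. *)
pose s : int := ((-1) ^+ b) ^+ d.
have s2 : (s%:~R : R) ^+ 2 = 1.
  by rewrite -rmorphXn /s -(exprM _ d) mulnC exprM sqrr_sign expr1n.
have nd : (val n)%:~R ^+ d = s%:~R * (a ^ d)%:R :> R.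
  by rewrite {1}(intEsign (val n)) -/b -/a -rmorphXn/= exprMn rmorphM/= natrX; congr (_ * _); rewrite rmorphXn.
have := H (s * j) _ q0.
have -> : nu - (s * j)%:~R / (a ^ d)%:R = - (s%:~R * (j%:~R - nu * (val n)%:~R ^+ d)) / (a ^ d)%:R.
  rewrite nd rmorphM/=; apply: (@mulIf _ (a ^ d)%:R); first by rewrite gt_eqF.
  rewrite mulrBl !divfK ?gt_eqF//.
  transitivity (nu * (a ^ d)%:R * (s%:~R ^+ 2) - s%:~R * j%:~R); last by ring.
  by rewrite s2 mulr1.
have ns : `|s%:~R : R| = 1.
  by apply/eqP; rewrite -sqrp_eq1 ?normr_ge0// real_normK ?num_real// s2.
rewrite normrM normrN normrM ns mul1r normfV (gtr0_norm q0') ltr_pdivlMr// => h.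
apply: le_trans (ltW h); rewrite -mulrA ler_pM2l//.
rewrite -{2}(powRr1 (ltW q0')) -powRD ?(gt_eqF q0') ?implybT//.
by rewrite natrX -powR_mulrn ?ler0n// -powRrM le_eqVlt; apply/orP; left; apply/eqP; congr (_ `^ _); ring.
Qed.

Lemma cos_sinD_int (x : R) (j : int) :
  cos (2 * pi * j%:~R + x) = cos x /\ sin (2 * pi * j%:~R + x) = sin x.
Proof.
have H (k : nat) (y : R) : cos (2 * pi * k%:R + y) = cos y /\ sin (2 * pi * k%:R + y) = sin y.
  have -> : 2 * pi * k%:R + y = y + pi *+ 2 *+ k.
    by rewrite -[_ *+ k]mulr_natr -[pi *+ 2]mulr_natr; ring.
  by rewrite (periodicn (@cosD2pi R)) (periodicn (@sinD2pi R)).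
case: j => k; first exact: H.
have [h1 h2] := H k.+1 (2 * pi * (Negz k)%:~R + x).
have e : 2 * pi * k.+1%:R + (2 * pi * (Negz k)%:~R + x) = x.
  by rewrite NegzE rmorphN/=; ring.
by rewrite -h1 -h2 e.
Qed.

End Arithmetic.

(** * From exponential decay at small rates to algebraic decay *)

Section Decay.
Variables (R : realType) (c eta : R).
Hypotheses (c0 : 0 < c) (eta0 : 0 < eta).

(** With [p = 1 + eta], [u (1 + sqrt s) ^ 2 <= 2 (1 + u s)] because [u <= 1], and the right side is
    at most a multiple of [exp (c u s / p)]; it remains to raise to the power [p]. Thus powers of
    [u], a loss of regularity, are traded for decay in [s] uniform in [u]. *)
Lemma decay_bound : exists2 m : R, 0 < m & forall u s, 0 <= u <= 1 -> 0 < s ->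
  u `^ (1 + eta) * expR (- (c * u * s)) <= m * decay eta s.
Proof.
pose p := 1 + eta; have p0 : 0 < p by rewrite addr_gt0.
pose K := 2 * (1 + p / c).
have pc : 0 < p / c by rewrite divr_gt0.
have K0 : 0 < K by rewrite /K; lra.
exists (K `^ p); first by rewrite powR_gt0.
move=> u s /andP[u0 u1] s0; have q0 : 0 <= Num.sqrt s by rewrite sqrtr_ge0.
have us : 0 <= u * s by rewrite mulr_ge0// ltW.
have h1 : u * (1 + Num.sqrt s) ^+ 2 <= K * expR (c * u * s / p).
  apply: (@le_trans _ _ (2 * (1 + u * s))).
    have : (1 + Num.sqrt s) ^+ 2 <= 2 * (1 + s).
      by have := sqr_ge0 (1 - Num.sqrt s); have := sqr_sqrtr (ltW s0); lra.
    by move=> /(ler_wpM2l u0) /le_trans; apply; lra.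
  rewrite /K -mulrA ler_pM2l//.
  apply: (@le_trans _ _ ((1 + p / c) * (1 + c * u * s / p))); last first.
    by rewrite ler_pM2l ?expR_ge1Dx//; lra.
  have -> : (1 + p / c) * (1 + c * u * s / p) = 1 + u * s + p / c + c * u * s / p.
    by field; rewrite !gt_eqF.
  have : 0 <= c * u * s / p by rewrite divr_ge0 ?(ltW p0)// -mulrA mulr_ge0 ?(ltW c0).
  lra.
have w0 : 0 <= u * (1 + Num.sqrt s) ^+ 2 by rewrite mulr_ge0// sqr_ge0.
have w1 : 0 <= K * expR (c * u * s / p) by rewrite mulr_ge0 ?expR_ge0// ltW.
have : (u * (1 + Num.sqrt s) ^+ 2) `^ p <= (K * expR (c * u * s / p)) `^ p.
  by apply: ge0_ler_powR h1; rewrite ?nnegrE// ltW.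
rewrite (powRM _ u0 (sqr_ge0 _)) (powRM _ (ltW K0) (expR_ge0 _)) -expRM divfK ?gt_eqF//.
rewrite -powR_mulrn ?addr_ge0// -powRrM => h2.
have d0 : 0 < (1 + Num.sqrt s) `^ (2 * p) by rewrite powR_gt0// ltr_pwDl.
have -> : decay eta s = ((1 + Num.sqrt s) `^ (2 * p))^-1.
  by rewrite -powRN /decay; congr (_ `^ _); rewrite /p; ring.
rewrite ler_pdivlMr// mulrAC expRN ler_pdivrMr ?expR_gt0//.
Qed.

End Decay.

(** * Finite partial sums of the norms of the Hilbert scale *)

Section HilbertScale.
Variable R : realType.
Implicit Types (h : R).

Lemma sqr_normRcomplex (z : Rcomplex R) : `|z| ^+ 2 = complex.Re z ^+ 2 + complex.Im z ^+ 2.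
Proof.
case: z => a b; rewrite [X in X ^+ 2 = _](_ : _ = Num.sqrt (a ^+ 2 + b ^+ 2))//.
by rewrite sqr_sqrtr// addr_ge0 ?sqr_ge0.
Qed.

(** Membership in [scale h] and norm bounds reduce to bounds on these sums uniform in [X], so that
    the estimates deal with finitely many modes. *)
Definition wsum h (X : {fset mode}) (u : fseries R) : R :=
  \sum_(n <- X) weight h n * `|u n| ^+ 2.

Lemma weight_gt0 h n : 0 < weight h n.
Proof. by apply: powR_gt0; rewrite ltr0n absz_gt0; exact: valP n. Qed.

Lemma hnorm_sqr h (u : Hilb h) : `|u| ^+ 2 = fine (sqnorm h (coef u)).
Proof. by rewrite sqr_sqrtr// fine_ge0// sqnorm_ge0. Qed.

Lemma sqnorm_fin h (u : Hilb h) : (sqnorm h (coef u) \is a fin_num)%E.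
Proof. by rewrite ge0_fin_numE ?sqnorm_ge0//; have /asboolP := valP u. Qed.

Lemma wsum_le h (u : Hilb h) X : wsum h X (coef u) <= `|u| ^+ 2.
Proof.
rewrite hnorm_sqr -lee_fin (fineK (sqnorm_fin u)).
apply: ereal_sup_ubound; exists [set` X]; first by split=> //; exact: finite_fset.
by rewrite fsbig_finite//= sumEFin set_fsetK.
Qed.

Lemma sqnorm_le h u (M : R) : (forall X, wsum h X u <= M) -> (sqnorm h u <= M%:E)%E.
Proof.
move=> H; apply: ge_ereal_sup => _ [A [finA _] <-].
by rewrite fsbig_finite//= sumEFin lee_fin; apply: H.
Qed.

Lemma wsum_scale h u (M : R) : (forall X, wsum h X u <= M) -> u \in scale h.
Proof. by move=> /sqnorm_le H; apply/asboolP; rewrite (le_lt_trans H)// ltry. Qed.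

Lemma hnorm_le h (u : Hilb h) (M : R) : (forall X, wsum h X (coef u) <= M) -> `|u| ^+ 2 <= M.
Proof. by move=> /sqnorm_le; rewrite hnorm_sqr -lee_fin fineK// sqnorm_fin. Qed.

Lemma sum_support (f : mode -> R) (X : {fset mode}) (s : seq mode) : uniq s ->
  {subset X <= s} -> (forall n, n \notin X -> f n = 0) ->
  \sum_(n <- s) f n = \sum_(n <- X) f n.
Proof.
move=> us Xs f0; rewrite (bigID (fun n => n \in X))/= [X in _ + X]big1 ?addr0//.
rewrite -big_filter; apply: perm_big; apply: uniq_perm; rewrite ?filter_uniq ?fset_uniq//.
by move=> n; rewrite mem_filter; case: (boolP (n \in X)) => //= /Xs.
Qed.

Lemma wsum_support h u (X Y : {fset mode}) : (forall n, n \notin X -> u n = 0) ->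
  wsum h Y u <= wsum h X u.
Proof.
move=> u0; pose s := (X `|` Y)%fset.
have f0 n : n \notin X -> weight h n * `|u n| ^+ 2 = 0.
  by move=> /u0 ->; rewrite normr0 expr0n mulr0.
rewrite /wsum -(@sum_support _ X s) ?fset_uniq//; last by move=> n nX; rewrite inE nX.
have ge0 n : 0 <= weight h n * `|u n| ^+ 2 by rewrite mulr_ge0 ?sqr_ge0// ltW// weight_gt0.
rewrite [leRHS](perm_big ((Y : seq mode) ++ [seq n <- s | n \notin Y])); last first.
  apply: uniq_perm; first exact: fset_uniq.
    rewrite cat_uniq fset_uniq filter_uniq ?fset_uniq// andbT/=.
    by apply/hasPn => n; rewrite mem_filter => /andP[].
  move=> n; rewrite mem_cat mem_filter; case: (boolP (n \in Y)) => nY //=.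
  by rewrite in_fsetU nY orbT.
by rewrite big_cat/= lerDl sumr_ge0.
Qed.

Lemma le_wsum h X (u v : fseries R) : (forall n, `|u n| <= `|v n|) -> wsum h X u <= wsum h X v.
Proof.
move=> uv; apply: ler_sum => n _; apply: ler_wpM2l; first exact/ltW/weight_gt0.
by rewrite ler_sqr ?nnegrE.
Qed.

Lemma weight_le h h' n : h <= h' -> weight h n <= weight h' n.
Proof.
move=> hh; apply: ler_powR; first by rewrite ler1n absz_gt0; exact: valP n.
by rewrite ler_pM2l.
Qed.

Lemma coef_le (u : Hilb (0 : R)) n : `|coef u n| <= `|u|.
Proof.
rewrite -ler_sqr ?nnegrE//; apply: le_trans (wsum_le u [fset n]%fset).
by rewrite /wsum big_seq_fset1 /weight mulr0 powRr0 mul1r.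
Qed.

Lemma Re_coef_le (u : Hilb (0 : R)) n : `|complex.Re (coef u n)| <= `|u|.
Proof.
apply: le_trans (coef_le u n); rewrite -ler_sqr ?nnegrE// sqr_normRcomplex.
by rewrite real_normK ?num_real// lerDl sqr_ge0.
Qed.

Lemma Im_coef_le (u : Hilb (0 : R)) n : `|complex.Im (coef u n)| <= `|u|.
Proof.
apply: le_trans (coef_le u n); rewrite -ler_sqr ?nnegrE// sqr_normRcomplex.
by rewrite real_normK ?num_real// lerDr sqr_ge0.
Qed.

End HilbertScale.

(** * First-order calculus with jets *)

Section FirstOrder.
Variable R : realType.

(** A predicate on bare functions, since the first-order part [fun v => D x [:: v]] of a jet carries
    no linear structure. *)
Definition lin (V W : lmodType R) (l : V -> W) := forall a v w, l (a *: v + w) = a *: l v + l w.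

Lemma lin0 (V W : lmodType R) (l : V -> W) : lin l -> l 0 = 0.
Proof. by move=> H; have := H (-1) 0 0; rewrite scaler0 addr0 scaleN1r addNr. Qed.

Lemma linZ (V W : lmodType R) (l : V -> W) a v : lin l -> l (a *: v) = a *: l v.
Proof. by move=> H; have := H a v 0; rewrite addr0 (lin0 H) addr0. Qed.

Lemma linB (V W : lmodType R) (l : V -> W) v w : lin l -> l (v - w) = l v - l w.
Proof. by move=> H; rewrite addrC -scaleN1r H scaleN1r addrC. Qed.

Section IsDerive.
Variables (V W : normedModType R).

Lemma is_derive_linear_approx (f : V -> W) (x v : V) (l : V -> W) : lin l ->
  (forall e : R, 0 < e -> \forall y \near x, `|f y - f x - l (y - x)| <= e * `|y - x|) ->
  is_derive x v f (l v).
Proof.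
move=> ll H.
have cv : (fun h : R => h^-1 *: ((f \o shift x) (h *: v) - f x)) @ 0^' --> l v.
  apply/cvgrPdist_le => /= e e0.
  (* The [1] covers the case [v = 0]. *)
  pose e' := e / (`|v| + 1); have v1 : 0 < `|v| + 1 by rewrite ltr_pwDr.
  have e'0 : 0 < e' by rewrite divr_gt0.
  have cvx : (fun h : R => h *: v + x) @ 0^' --> x.
    rewrite -[X in _ --> X]add0r -[X in _ --> X + _](scale0r v).
    apply: cvgD; last exact: cvg_cst.
    apply: cvgZr_tmp; exact: (@nbhs_dnbhs _ (0 : R)).
  have Hn : \forall h \near 0^', `|f (h *: v + x) - f x - l (h *: v + x - x)| <=
      e' * `|h *: v + x - x| := cvx _ (H e' e'0).
  near=> h.
  have h0 : h != 0 by near: h; exact: nbhs_dnbhs_neq.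
  have : `|f (h *: v + x) - f x - l (h *: v + x - x)| <= e' * `|h *: v + x - x| by near: h.
  rewrite addrK (linZ _ _ ll) normrZ distrC => K.
  have -> : l v - h^-1 *: (f (h *: v + x) - f x) = h^-1 *: (h *: l v - (f (h *: v + x) - f x)).
    by rewrite [RHS]scalerBr scalerA mulVf// scale1r.
  rewrite normrZ normfV ler_pdivrMl ?normr_gt0//; apply: le_trans K _.
  rewrite mulrCA; apply: ler_wpM2l => //.
  by rewrite /e' mulrAC ler_pdivrMr// ler_pM2l// lerDl.
split; first by apply/cvg_ex; exists (l v).
exact/cvg_lim.
Unshelve. all: by end_near. Qed.

Variables (f : V -> W) (D : V -> seq V -> W).
Hypothesis jet : is_jet 1 f D.

Lemma jet_lin x : lin (fun v => D x [:: v]).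
Proof. by move=> a v w; apply: (jet_multilinear jet x (s1 := [::]) (s2 := [::])). Qed.

Lemma jet_approx x (e : R) : 0 < e ->
  \forall y \near x, `|f y - f x - D x [:: y - x]| <= e * `|y - x|.
Proof.
move=> e0; have := jet_derivative jet x (k := 0) (ltn0Sn _) e0; apply: filterS => y.
by move=> /(_ [::] erefl); rewrite !(jet0 jet) big_nil mulr1.
Qed.

Lemma jet_bound x : exists2 C : R, 0 <= C & forall v, `|D x [:: v]| <= C * `|v|.
Proof.
have [C HC] := jet_bounded jet x (k := 1) (leqnn _).
exists `|C| => // v; have := HC [:: v] erefl; rewrite big_seq1 => /le_trans; apply.
by rewrite ler_wpM2r// ler_norm.
Qed.

Lemma jet_derive x v : 'D_v f x = D x [:: v].
Proof.
have := is_derive_linear_approx v (@jet_lin x) (fun e e0 => jet_approx x e0).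
by case.
Qed.

End IsDerive.

Section Functional.
Variables (W : normedModType R) (u : (R^o * R^o)%type -> W) (D : (R^o * R^o)%type -> seq (R^o * R^o)%type -> W).
Variables (l : W -> R^o).
Hypotheses (jet : is_jet 1 u D) (ll : lin l) (l1 : forall w, `|l w| <= `|w|).

(** Reduces a Hilbert-valued map of the plane to scalar [C^1] functions; [l] will be the real or
    imaginary part of a Fourier coefficient. *)
Lemma jet_C1 : C1 setT (fun s t => l (u (s, t)))
  (fun s t => l (D (s, t) [:: (1, 0)])) (fun s t => l (D (s, t) [:: (0, 1)])).
Proof.
have lip (z : (R^o * R^o)%type) (g : R^o -> (R^o * R^o)%type) (v : (R^o * R^o)%type) r :
    g r = z -> (forall r', g r' - g r = (r' - r) *: v) -> `|v| <= 1 ->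
    is_derive r 1 (fun r => l (u (g r)) : R^o) (l (D z [:: v])).
  move=> gz gv v1; pose m (q : R^o) : R^o := q *: l (D z [:: v]).
  have <- : m 1 = l (D z [:: v]) by rewrite /m scale1r.
  apply: is_derive_linear_approx.
    by move=> a p q; rewrite /m scalerDl scalerA.
  move=> e e0.
  have cg : {for r, continuous g}.
    apply/cvgrPdist_le => e' e'0; near=> r'.
    rewrite distrC gv normrZ.
    apply: (@le_trans _ _ `|r - r'|); first by rewrite distrC ler_piMr.
    near: r'; have /cvgrPdist_le := @cvg_id _ (nbhs r); exact.
  have Hz : \forall y \near g r, `|u y - u z - D z [:: y - z]| <= e * `|y - z|.
    by rewrite gz; exact: jet_approx.
  have : \forall r' \near r, `|u (g r') - u z - D z [:: g r' - z]| <= e * `|g r' - z| := cg _ Hz.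
  have gv' r' : g r' - z = (r' - r) *: v by rewrite -gz gv.
  apply: filterS => r'; rewrite gv' gz => K.
  have -> : l (u (g r')) - l (u z) - m (r' - r) = l (u (g r') - u z - D z [:: (r' - r) *: v]).
    by rewrite !(linB _ _ ll) (linZ _ _ (jet_lin jet z)) (linZ _ _ ll).
  apply: le_trans (l1 _) _; apply: le_trans K _.
  by rewrite ler_wpM2l ?(ltW e0)// normrZ ler_piMr.
have cD v : `|v| <= 1 -> forall s t, cont2 (fun s t => l (D (s, t) [:: v])) s t.
  move=> v1 s t; apply/cvgrPdist_le => e e0.
  have := jet_continuous jet (s, t) e0; apply: filterS => -[s' t'] /(_ [:: v] erefl).
  rewrite big_seq1 /= -(linB _ _ ll) => K.
  apply: le_trans (l1 _) _; rewrite distrC; apply: le_trans K _.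
  by rewrite ler_piMr// ltW.
have n10 : `|((1, 0) : (R^o * R^o)%type)| <= 1.
  by rewrite prod_normE/= normr1 normr0 ge_max ler01 lexx.
have n01 : `|((0, 1) : (R^o * R^o)%type)| <= 1.
  by rewrite prod_normE/= normr1 normr0 ge_max ler01 lexx.
split=> s t _.
- apply: (lip (s, t) (fun s => (s, t))) => // r'.
  by congr (_, _); rewrite /= ?subrr ?scaler0// /GRing.scale/= mulr1.
- apply: (lip (s, t) (fun t => (s, t))) => // r'.
  by congr (_, _); rewrite /= ?subrr ?scaler0// /GRing.scale/= mulr1.
(* The first-order approximation with error [1] and the bound [C] on the derivative give the
   Lipschitz constant [1 + C] at this point, hence continuity. *)
- have [C C0 HC] := jet_bound jet (s, t).
  apply/cvgrPdist_le => e e0.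
  have C1 : 0 < 1 + C by rewrite ltr_pwDl.
  have h1 := jet_approx jet (s, t) (@ltr01 R).
  have h2 : \forall y \near ((s, t) : (R^o * R^o)%type), `|(s, t) - y| <= e / (1 + C).
    have /cvgrPdist_le := @cvg_id _ (nbhs ((s, t) : (R^o * R^o)%type)).
    by apply; rewrite divr_gt0.
  apply: filterS2 h1 h2 => -[s' t'] K1 K2.
  rewrite -(linB _ _ ll) distrC in K2 *; apply: le_trans (l1 _) _.
  rewrite distrC in K2.
  rewrite distrC -[_ - _](subrK (D (s, t) [:: (s', t') - (s, t)])).
  apply: le_trans (ler_normD _ _) _; apply: le_trans (lerD K1 (HC _)) _.
  by rewrite -mulrDl -ler_pdivlMl// mulrC distrC.
- exact: cD.
- exact: cD.
Unshelve. all: by end_near. Qed.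

End Functional.

End FirstOrder.

(** * The gradient in the norm of order [h] *)

Section Gradient.
Variable R : realType.
Implicit Types (X h t : R) (d k : nat) (F : R -> Hilb (0 : R) -> R).

Lemma jet_derive_comp (V W Z : normedModType R) (A : V -> W) (f : W -> Z)
    (D : W -> seq W -> Z) (u v : V) :
  lin A -> (forall z, `|A z| <= `|z|) -> is_jet 1 f D ->
  'D_v (f \o A) u = D (A u) [:: A v].
Proof.
move=> Al A1 jet.
have [a y z|e e0|//] := @is_derive_linear_approx R V Z (f \o A) u v (fun v => D (A u) [:: A v]).
  by rewrite Al (jet_lin jet).
have cA : {for u, continuous A}.
  apply/cvgrPdist_le => e' e'0.
  have /cvgrPdist_le/(_ _ e'0) := @cvg_id _ (nbhs u); apply: filterS => y.
  by rewrite -(linB _ _ Al); apply: le_trans.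
have : \forall y \near u, `|f (A y) - f (A u) - D (A u) [:: A y - A u]| <= e * `|A y - A u|
  := cA _ (jet_approx jet (A u) e0).
apply: filterS => y; rewrite -(linB _ _ Al) => /le_trans; apply.
by rewrite ler_wpM2l// ltW.
Qed.

Lemma complex_eq (z w : Rcomplex R) : complex.Re z = complex.Re w ->
  complex.Im z = complex.Im w -> z = w.
Proof. by case: z w => [a b] [c e] /= -> ->. Qed.

Lemma Rcomplex_mul_lin (m : Rcomplex R) : lin (fun u : Rcomplex R => m * u : Rcomplex R).
Proof.
case: m => m1 m2 a [u1 u2] [v1 v2]; apply: complex_eq.
  transitivity (m1 * (a * u1 + v1) - m2 * (a * u2 + v2)); first by [].
  transitivity (a * (m1 * u1 - m2 * u2) + (m1 * v1 - m2 * v2)); last by [].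
  by ring.
transitivity (m1 * (a * u2 + v2) + m2 * (a * u1 + v1)); first by [].
transitivity (a * (m1 * u2 + m2 * u1) + (m1 * v2 + m2 * v1)); last by [].
by ring.
Qed.

Lemma norm_Rcomplex_mul_le (m u : Rcomplex R) : `|m| <= 1 -> `|(m * u : Rcomplex R)| <= `|u|.
Proof.
move=> m1; have -> : `|(m * u : Rcomplex R)| = `|m| * `|u| by exact: Normc.normcM.
by rewrite ler_piMl.
Qed.

Lemma coefD h (u v : Hilb h) n : coef (u + v) n = coef u n + coef v n.
Proof. by []. Qed.

Lemma coefZ h a (u : Hilb h) n : coef (a *: u) n = a *: coef u n.
Proof. by []. Qed.

Lemma low_flow_scale h (h0 : 0 <= h) X d k t (u : Hilb (0 : R)) :
  coef (projV k (flow X d t u)) \in scale (- h).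
Proof.
apply: (@wsum_scale _ _ _ (`|projV k (flow X d t u)| ^+ 2)) => Y.
apply: le_trans (wsum_le _ Y); apply: ler_sum => n _.
by rewrite ler_wpM2r ?sqr_ge0// weight_le// oppr_le0.
Qed.

(* [u |-> (phi_t u)^k] as a map into the weak space of the extended nonlinearity *)
Definition lowflow h (h0 : 0 <= h) X d k t (u : Hilb (0 : R)) : Hilb (- h) :=
  MkHilb (low_flow_scale h0 X d k t u).

Lemma lowflow_lin h (h0 : 0 <= h) X d k t : lin (lowflow h0 X d k t).
Proof.
move=> a u v; apply: val_inj; apply/funext => n.
transitivity (low R k n * (expi (t * eigA X d n) * (a *: coef u n + coef v n))); first by [].
by rewrite !Rcomplex_mul_lin.
Qed.

Lemma lowflow_coef_le h (h0 : 0 <= h) X d k t u n :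
  `|coef (lowflow h0 X d k t u) n| <= `|coef u n|.
Proof.
apply: le_trans (norm_Rcomplex_mul_le _ (norm_low _ _ _)) _.
exact: norm_Rcomplex_mul_le (norm_expi _).
Qed.

Lemma lowflow_norm_le h (h0 : 0 <= h) X d k t u : `|lowflow h0 X d k t u| <= `|u|.
Proof.
rewrite -ler_sqr ?nnegrE//; apply: hnorm_le => Y; apply: le_trans (wsum_le u Y).
apply: le_trans (le_wsum _ _ (lowflow_coef_le h0 X d k t u)) _.
by apply: ler_sum => n _; rewrite ler_wpM2r ?sqr_ge0// weight_le// oppr_le0.
Qed.

(** The partial sums defining [inner] are constant once all modes of [Y] are included. *)
Lemma inner_support (g v : Hilb (0 : R)) (Y : {fset mode}) :
  (forall n, n \notin Y -> coef v n = 0) ->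
  inner g v = \sum_(n <- Y) complex.Re (coef g n * conjc (coef v n)).
Proof.
move=> v0; rewrite /inner; pose term (n : mode) : R := complex.Re (coef g n * conjc (coef v n)).
have [N NY] : exists N, forall n, n \in Y -> (absz (val n) < N)%N.
  suff [N NY] : exists N, forall n, n \in (Y : seq mode) -> (absz (val n) < N)%N by exists N.
  elim: (Y : seq mode) => [|m s [N NY]]; first by exists 0%N.
  exists (maxn (absz (val m)).+1 N) => n; rewrite inE leq_max => /orP[/eqP ->|/NY ->].
    by rewrite leqnn.
  by rewrite orbT.
have term0 n : n \notin Y -> term n = 0.
  move=> /v0 e; rewrite /term e /conjc; case: (coef g n) => a b /=.
  by rewrite oppr0 !mulr0 subrr.
apply: cvg_lim => //.
apply: (@cvg_trans _ ((fun=> \sum_(n <- Y) term n) @ \oo)); last exact: cvg_cst.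
apply: near_eq_cvg; near=> k.
have Nk : (N <= k)%N by near: k; exact: nbhs_infty_ge.
rewrite big_split/= !big_mkord.
pose s := [seq posmode (val j) | j <- index_enum 'I_k] ++ [seq negmode (val j) | j <- index_enum 'I_k].
have us : uniq s.
  rewrite cat_uniq !map_inj_uniq ?index_enum_uniq//=.
  - rewrite andbT; apply/hasPn => n /mapP[j _ ->]; apply/mapP => -[i _].
    by move=> /(congr1 val).
  - by move=> i j /(congr1 val)[/val_inj].
  - by move=> i j /(congr1 val)[/val_inj].
have Ys : {subset Y <= s}.
  move=> n nY; have nk : (absz (val n) < k)%N by apply: leq_trans Nk; exact: NY.
  rewrite mem_cat; apply/orP; case: n nY nk => -[[|j]|j] n0 nY nk //.
    left; apply/mapP; exists (Ordinal (ltnW nk)); first exact: mem_index_enum.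
    exact: val_inj.
  right; apply/mapP; exists (Ordinal (ltnW nk)); first exact: mem_index_enum.
  exact: val_inj.
by rewrite -(sum_support us Ys term0) big_cat/= !big_map.
Unshelve. all: by end_near. Qed.

(** Duality: for [v = weight h g] restricted to [Y], [inner g v = Q], while [A v] has squared norm
    at most [Q] in the weak space. As the derivative of [Fe] is bounded by [C] there,
    [Q <= C sqrt Q]. Finiteness of [Y] puts [v] in the phase space. *)
Lemma gradient_bound h X d k t F (Fe : R -> Hilb (- h) -> R) (C : R) u g (Y : {fset mode}) :
  0 <= h -> extends F Fe -> C_norm_le 1 (Fe t : _ -> R^o) C ->
  is_gradient (Gt X d (Ftrunc k F) t) u g -> wsum h Y (coef g) <= C ^+ 2.
Proof.
move=> h0 ext [D jet DC] [df grad].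
pose vs : fseries R := fun n => if n \in Y then weight h n *: coef g n else 0.
have vs0 n : n \notin Y -> vs n = 0 by rewrite /vs => /negbTE ->.
have vsP : vs \in scale (0 : R).
  by apply: (@wsum_scale _ _ _ (wsum 0 Y vs)) => Z; exact: wsum_support.
pose v : Hilb (0 : R) := MkHilb vsP.
pose A := lowflow h0 X d k t.
set Q := wsum h Y (coef g).
have Q0 : 0 <= Q.
  by apply: sumr_ge0 => n _; rewrite mulr_ge0 ?sqr_ge0// ltW// weight_gt0.
have QE : inner g v = Q.
  rewrite (@inner_support g v Y) //; apply: eq_big_seq => n nY.
  rewrite /= /vs nY sqr_normRcomplex; case: (coef g n) => a b.
  by transitivity (a * (weight h n * a) - b * - (weight h n * b)); [|rewrite /=; ring].
have Av : `|A v| ^+ 2 <= Q.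
  apply: hnorm_le => Z; apply: le_trans (le_wsum _ _ (lowflow_coef_le h0 X d k t v)) _.
  apply: le_trans (wsum_support (- h) Z vs0) _.
  rewrite /Q le_eqVlt; apply/orP; left; apply/eqP; apply: eq_big_seq => n nY.
  rewrite /= /vs nY !sqr_normRcomplex; case: (coef g n) => a b.
  transitivity (weight (- h) n * ((weight h n * a) ^+ 2 + (weight h n * b) ^+ 2)); first by [].
  have -> : weight (- h) n = (weight h n)^-1 by rewrite /weight mulrN powRN.
  by rewrite /=; field; rewrite gt_eqF// weight_gt0.
have fE w : Gt X d (Ftrunc k F) t w = Fe t (A w).
  by symmetry; apply: ext.
have der : 'D_v (Gt X d (Ftrunc k F) t : _ -> R^o) u = D (A u) [:: A v].
  have -> : Gt X d (Ftrunc k F) t = Fe t \o A by apply/funext.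
  apply: (jet_derive_comp _ _ _ _ jet); first exact: lowflow_lin.
  exact: lowflow_norm_le.
have QD : Q = D (A u) [:: A v] by rewrite -QE -grad -der deriveE.
have := DC (A u) [:: A v] isT; rewrite big_seq1 -QD => QC.
have [->|Qn0] := eqVneq Q 0; first exact: sqr_ge0.
have Qp : 0 < Q by rewrite lt_neqAle eq_sym Qn0.
(* [C] may a priori be negative; the product is not, as it dominates [|Q|]. *)
have C0 : 0 <= C * `|A v| by apply: le_trans QC.
have : Q ^+ 2 <= (C * `|A v|) ^+ 2.
  by rewrite ler_sqr ?nnegrE//; apply: le_trans QC; exact: ler_norm.
rewrite exprMn => h1.
have h2 : C ^+ 2 * `|A v| ^+ 2 <= C ^+ 2 * Q by rewrite ler_wpM2l ?sqr_ge0.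
have := le_trans h1 h2; rewrite expr2 ler_pM2r//.
Qed.

End Gradient.

(** * Limits and cut-off functions *)

Section Convergence.
Variable R : realType.

Lemma uniform_norm_le (U : choiceType) (V : normedModType R) (A : set U)
    (F : set_system (U -> V)) (f : U -> V) : Filter F -> {uniform A, F --> f} ->
  forall e : R, 0 < e -> F [set g | forall x, A x -> `|f x - g x| <= e].
Proof.
move=> FF H e e0; apply: H; apply/uniform_nbhs.
exists [set xy | ball xy.1 e xy.2]; split; first by rewrite -entourage_ballE; exists e.
by move=> g gA x Ax; have := gA x Ax; rewrite -ball_normE /= => /ltW.
Qed.

(** Singletons are compact, so compact convergence gives convergence at each point. *)
Lemma family_compact_norm_le (U : topologicalType) (V : normedModType R)
    (F : set_system (U -> V)) (f : U -> V) : Filter F -> {family compact, F --> f} ->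
  forall x (e : R), 0 < e -> F [set g | `|f x - g x| <= e].
Proof.
move=> FF /fam_cvgP H x e e0.
have := @uniform_norm_le U V [set x] F f FF (H _ (@compact_set1 _ x)) e e0.
by apply: filterS => g /(_ x erefl).
Qed.

(** A finite sum is continuous for convergence in the phase space, so a bound of order [h] survives
    although convergence is not known in that norm. *)
Lemma wsum_limit h (X : {fset mode}) (u : Hilb (0 : R)) (w : nat -> Hilb (0 : R)) (M : R) :
  (forall e : R, 0 < e -> \forall m \near \oo, `|u - w m| <= e) ->
  (forall m, wsum h X (coef (w m)) <= M) -> wsum h X (coef u) <= M.
Proof.
move=> wu wM.
have cn n : `|coef (w m) n| @[m --> \oo] --> `|coef u n|.
  apply/cvgrPdist_le => e e0; apply: filterS (wu e e0) => m; apply: le_trans.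
  apply: le_trans (ler_dist_dist _ _) _.
  exact: (coef_le (u - w m) n).
have cs : wsum h X (coef (w m)) @[m --> \oo] --> wsum h X (coef u).
  rewrite /wsum; elim: (X : seq mode) => [|n s IH].
    rewrite big_nil (_ : (fun m => _) = (fun=> 0)); first exact: cvg_cst.
    by apply/funext => m; rewrite big_nil.
  rewrite big_cons (_ : (fun m => _) = (fun m => weight h n * `|coef (w m) n| ^+ 2 +
    \sum_(n <- s) weight h n * `|coef (w m) n| ^+ 2)).
    apply: cvgD => //; apply: cvgM; first exact: cvg_cst.
    by rewrite expr2; under eq_fun do rewrite expr2; apply: cvgM.
  by apply/funext => m; rewrite big_cons.
apply: (@closed_cvg _ _ \oo _ (fun m => wsum h X (coef (w m))) (fun x => x <= M) _ _ _ cs).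
  exact: closed_le.
exact: nearW.
Qed.

Lemma smooth_is_derive (f : R^o -> R^o) x : smooth f ->
  is_derive (x : R^o) 1 f (derive1 f x).
Proof.
move=> sf; have [D jet] := sf 1%N.
have H := is_derive_linear_approx (1 : R^o) (@jet_lin R _ _ _ _ jet x) (fun e e0 => jet_approx jet x e0).
by rewrite derive1E; case: H => dH _; exact: DeriveDef.
Qed.

(** Each transition interval has length [1] and slope at most [2] inside; the bound is uniform in
    [k]. *)
Lemma cutoff_k_le2 k (phi : R -> R) s : cutoff_k k phi -> `|phi s| <= 2.
Proof.
move=> [sm left right mid sl sr].
have D x : is_derive (x : R^o) 1 phi (derive1 phi x) by exact: smooth_is_derive.
have bnd a b : a <= b -> b - a <= 1 -> (forall x, a < x < b -> `|derive1 phi x| <= 2) ->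
    `|phi b - phi a| <= 2.
  move=> ab ba1 H; have [-> |anb] := eqVneq a b; first by rewrite subrr normr0.
  have altb : a < b by rewrite lt_neqAle anb.
  have [|c cab ->] := @MVT R phi (derive1 phi) a b altb (fun x _ => D x).
    by apply: continuous_subspaceT => x; exact: is_derive_continuous (D x).
  rewrite normrM; have : `|b - a| <= 1 by rewrite ger0_norm ?subr_ge0.
  move: cab; rewrite in_itv/= => /H h1 h2.
  by rewrite -[2]mulr1; apply: ler_pM.
have k2 : (2 * k)%N%:R + 1 = (2 * k + 1)%N%:R :> R by rewrite [in RHS]natrD.
have [s1|s1] := lerP s (-1); first by rewrite left// normr0.
have [s0|s0] := ltrP s 0.
  rewrite -[phi s]subr0 -(left (-1))//; apply: bnd; [lra|lra|].
  move=> x /andP[_ xs]; have := sl x (lt_trans xs s0).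
  by move=> /andP[h1 h2]; rewrite ger0_norm.
have [s2|s2] := lerP s (2 * k)%N%:R; first by rewrite mid ?s0// normr1; lra.
have [s3|s3] := lerP (2 * k + 1)%N%:R s; first by rewrite right// normr0.
rewrite -[phi s]subr0 -(right (2 * k + 1)%N%:R)// distrC; apply: bnd; first exact: ltW.
  by move: s2 s3; rewrite -k2; lra.
move=> x /andP[sx _]; have := sr x (le_lt_trans s0 sx).
by move=> /andP[h1 h2]; rewrite ler0_norm//; lra.
Qed.

End Convergence.

(** * The uniform bound for truncated Floer curves *)

Section FloerBound.
Variable R : realType.
Implicit Types (X T h : R) (d k : nat) (F : R -> Hilb (0 : R) -> R).

Lemma floer_far X T d F k phi u (e : R) : floer_curve X T d F k phi u -> 0 < e ->
  exists S : R, forall s t, S <= `|s| -> `|u (s, t)| <= e.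
Proof.
move=> [_ _ _ _ Hp Hn] e0.
have [Sp [_ HSp]] := uniform_norm_le (fmap_filter _ _) Hp e0.
have [Sn [_ HSn]] := uniform_norm_le (fmap_filter _ _) Hn e0.
(* The [1] turns the non-strict bound on [|s|] into the strict ones required at both ends. *)
exists (`|Sp| + `|Sn| + 1) => s t; case: (ler0P s) => s0 Ss.
  have : s < Sn by have := ler_norm (- Sn); rewrite normrN; have := normr_ge0 Sp; lra.
  by move=> /HSn /(_ t I); rewrite sub0r normrN.
have : Sp < s by have := ler_norm Sp; have := normr_ge0 Sn; lra.
by move=> /HSp /(_ t I); rewrite sub0r normrN.
Qed.

Lemma Re_lin n : lin (fun u : Hilb (0 : R) => complex.Re (coef u n) : R^o).
Proof. by move=> a u v; rewrite coefD coefZ; case: (coef u n) (coef v n) => [? ?] []. Qed.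

Lemma Im_lin n : lin (fun u : Hilb (0 : R) => complex.Im (coef u n) : R^o).
Proof. by move=> a u v; rewrite coefD coefZ; case: (coef u n) (coef v n) => [? ?] []. Qed.

(** The [n]-th component of the Floer equation. [f] and [g] are produced before the gradient [v],
    which is given point by point; their modulus is what the estimate uses. *)
Lemma floer_coef X T d F k phi u n : floer_curve X T d F k phi u ->
  exists f g : R -> R -> R,
    dbar setT (fun s t => complex.Re (coef (u (s, t)) n)) (fun s t => complex.Im (coef (u (s, t)) n)) f g /\
    forall s t v, is_gradient (Gt X d (Ftrunc k F) t) (u (s, t)) v ->
      dels u (s, t) + Jop (delt u (s, t)) + phi s *: v = 0 ->
      f s t ^+ 2 + g s t ^+ 2 = phi s ^+ 2 * `|coef v n| ^+ 2.
Proof.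
move=> [_ sm _ _ _ _]; have [D jet] := sm 1%N.
have Cx := jet_C1 jet (Re_lin n) (fun w => Re_coef_le w n).
have Cy := jet_C1 jet (Im_lin n) (fun w => Im_coef_le w n).
eexists _, _; split.
  by eexists (_, _); [exact: Cx|eexists (_, _); [exact: Cy|move=> s t _ /=; split]].
move=> s t v _ /(congr1 (fun w : Hilb 0 => coef w n)).
rewrite /dels /delt !(jet_derive jet) !coefD coefZ sqr_normRcomplex.
rewrite [coef (Jop _) n](_ : _ = ((0 +i* 1)%C * coef (D (s, t) [:: (0, 1)]) n)%R) //.
case: (coef (D (s, t) [:: (1, 0)]) n) => a1 a2.
case: (coef (D (s, t) [:: (0, 1)]) n) => b1 b2.
case: (coef v n) => v1 v2 e.
have e1 : a1 + (0 * b1 - 1 * b2) + phi s * v1 = 0 := congr1 (@complex.Re R) e.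
have e2 : a2 + (0 * b2 + 1 * b1) + phi s * v2 = 0 := congr1 (@complex.Im R) e.
rewrite /=.
have -> : a1 - b2 = - (phi s * v1) by lra.
have -> : a2 + b1 = - (phi s * v2) by lra.
ring.
Qed.

Lemma floer_twist_coef X T d F k phi u n s t : floer_curve X T d F k phi u ->
  let th := - T * eigA X d n in
  complex.Re (coef (u (s, t + T)) n) =
    cos th * complex.Re (coef (u (s, t)) n) - sin th * complex.Im (coef (u (s, t)) n) /\
  complex.Im (coef (u (s, t + T)) n) =
    sin th * complex.Re (coef (u (s, t)) n) + cos th * complex.Im (coef (u (s, t)) n).
Proof.
move=> [_ _ _ tw _ _] th; rewrite tw.
rewrite [coef (flow _ _ _ _) n](_ : _ = (expi th * coef (u (s, t)) n)%R) //.
by case: (coef (u (s, t)) n) => a b; split => /=; ring.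
Qed.

(** [M] is chosen before [k], the curve, the point and [Y], so that the bound survives the
    limits. *)
Lemma floer_bound X T h d F : A_admissible X T h d F -> exists M : R,
  forall k phi u, floer_curve X T d F k phi u -> cutoff_k k phi -> forall p Y,
  wsum (h - d%:R * (irr_measure (freq X T d) - 1) - 1 / 2) Y (coef (u p)) <= M.
Proof.
move=> [d0 X0 T0 dio _ hdr [Fe [ext _] Fbd] _].
set r := irr_measure _; set sg := h - _ - _.
have d0' : 0 < d%:R :> R by rewrite ltr0n.
have r1 : 1 <= r := irr_measure_ge1 dio.
have h0 : 0 <= h by rewrite -/r in hdr; apply: ltW; apply: le_lt_trans hdr; rewrite mulr_ge0 ?ler0n//; lra.
have [C HC] := Fbd 1%N.
(* The slack [1 / (2 d)] is matched to the [1 / 2] in the regularity: it gives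
   [d (rho - 1) < d (r - 1) + 1 / 2], that is [be < ga]. *)
have [|rho rhoE /andP[rho1 rho2]] := irr_measure_approx (e := (2 * d%:R)^-1) dio.
  by rewrite invr_gt0 mulr_gt0.
rewrite -/r in rho2.
pose be := d%:R * (rho - 1); pose ga := d%:R * (r - 1) + 1 / 2.
have be0 : 0 < be by rewrite mulr_gt0// subr_gt0.
have bega : be < ga.
  have : d%:R * rho < d%:R * (r + (2 * d%:R)^-1) by rewrite ltr_pM2l.
  have -> : d%:R * (r + (2 * d%:R)^-1) = d%:R * r + 1 / 2 by field; rewrite gt_eqF.
  rewrite /be /ga; lra.
(* Chosen so that [be * (1 + eta) = ga = h - sg]: then [U ^ (1 + eta)] is exactly the factor
   [|n| ^ (sg - h)]. *)
pose eta := ga / be - 1.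
have eta0 : 0 < eta by rewrite subr_gt0 ltr_pdivlMr// mul1r.
have [c c0 Hc] := small_divisor d rhoE.
pose L := T / 2; have L0 : 0 < L by rewrite divr_gt0.
pose ka := pi / L; have ka0 : 0 < ka by rewrite divr_gt0// pi_gt0.
have kac0 : 0 < ka * c by rewrite mulr_gt0.
have [m m0 Hm] := decay_bound kac0 eta0.
pose nu := freq X T d.
(* The rates compatible with the twist form a coset of the integer multiples of [ka]; this integer
   selects the one between [0] and [ka]. *)
pose jn (n : mode) : int := (Num.Def.floor (nu * (val n)%:~R ^+ d) + 1)%R.
pose mu (n : mode) : R := ka * ((jn n)%:~R - nu * (val n)%:~R ^+ d).
pose U (n : mode) : R := (absz (val n))%:R `^ (- be).
have n1 (n : mode) : 1 <= (absz (val n))%:R :> R.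
  by rewrite ler1n absz_gt0; exact: valP n.
have n0 (n : mode) : (absz (val n))%:R != 0 :> R by rewrite gt_eqF// (lt_le_trans ltr01).
have U01 n : 0 <= U n <= 1.
  rewrite powR_ge0/= -(powRr0 (absz (val n))%:R); apply: ler_powR; first exact: n1.
  by rewrite oppr_le0 ltW.
have fl n : nu * (val n)%:~R ^+ d < (jn n)%:~R by exact: floorD1_gt.
have fl' n : (jn n)%:~R - 1 <= nu * (val n)%:~R ^+ d by rewrite /jn intrD addrK floor_le.
have mu_ge n : ka * c * U n <= mu n.
  rewrite /mu -mulrA ler_pM2l//; have := Hc n (jn n); rewrite -/be -/(U n) ger0_norm//.
  by rewrite subr_ge0 ltW.
(* The small divisor for the neighbouring integer [jn n - 1] keeps [mu n] away from [ka]. *)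
have mu_le n : mu n + ka * c * U n <= ka.
  have := Hc n (jn n - 1); rewrite -/be -/(U n) intrB -/nu => hc.
  rewrite ler0_norm in hc; last by rewrite subr_le0.
  rewrite /mu -mulrA -mulrDr ler_piMr ?(ltW ka0)//; lra.
have mu0 n : 0 <= mu n.
  by apply: le_trans (mu_ge n); rewrite mulr_ge0 ?(ltW kac0)//; case/andP: (U01 n).
have muka n : mu n <= ka.
  apply: le_trans (mu_le n); rewrite lerDl mulr_ge0 ?(ltW kac0)//; by case/andP: (U01 n).
have wE n : weight sg n = (U n `^ (1 + eta)) ^+ 2 * weight h n.
  rewrite /weight -powR_mulrn ?powR_ge0// /U -!powRrM -powRD ?n0 ?implybT//.
  by congr (_ `^ _); rewrite /sg /eta /ga; field; rewrite gt_eqF.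
(* The factor [4 * C ^ 2] is the bound [G]: the bound [2] on the cut-off and the gradient bound [C],
   both squared. *)
exists ((8 * L * Num.sqrt ((1 + 2 * ka) / (2 * ka)) / eta * m) ^+ 2 * (4 * C ^+ 2) / (4 * L ^+ 2)).
move=> k phi u fu cphi [s0 t0] Y.
pose xx n s t := complex.Re (coef (u (s, t)) n).
pose yy n s t := complex.Im (coef (u (s, t)) n).
have [ff Hff] := choice (fun n => floer_coef n fu).
have [gg Hgg] := choice Hff.
pose sh (f : mode -> R -> R -> R) n s t := f n (s0 + s) (t0 + t).
have cosmu n : cos (2 * (mu n * L)) = cos (- T * eigA X d n) /\
               sin (2 * (mu n * L)) = sin (- T * eigA X d n).
  have -> : 2 * (mu n * L) = 2 * pi * (jn n)%:~R + (- T * eigA X d n).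
    have : (pi : R) != 0 by rewrite gt_eqF// pi_gt0.
    rewrite /mu /ka /L /nu /freq /eigA; move: (pi : R) => P P0.
    by field; rewrite P0 gt_eqF.
  exact: cos_sinD_int.
have tw n s : sh xx n s L = cos (2 * (mu n * L)) * sh xx n s (- L) - sin (2 * (mu n * L)) * sh yy n s (- L) /\
   sh yy n s L = sin (2 * (mu n * L)) * sh xx n s (- L) + cos (2 * (mu n * L)) * sh yy n s (- L).
  have [-> ->] := cosmu n; rewrite /sh.
  have -> : t0 + L = (t0 + - L) + T by rewrite /L; field.
  exact: (floer_twist_coef n (s0 + s) (t0 + - L) fu).
have := @modes_estimate R L eta L0 eta0 mode Y mu (weight sg) (weight h) (sh xx) (sh yy)
  (sh ff) (sh gg) m (4 * C ^+ 2) m0.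
have -> : \sum_(n <- Y) weight sg n * (sh xx n 0 0 ^+ 2 + sh yy n 0 0 ^+ 2) =
    wsum sg Y (coef (u (s0, t0))).
  by apply: eq_bigr => n _; rewrite sqr_normRcomplex /sh /xx /yy !addr0.
apply.
- by move=> n; exact/ltW/weight_gt0.
- by move=> n; exact: weight_gt0.
- exact: mu0.
- exact: muka.
- move=> n; have [[dd Cd [ee Ce de]] _] := Hgg n.
  eexists (_, _); first exact: C1_shift Cd.
  eexists (_, _); first exact: C1_shift Ce.
  by move=> s t _; exact: de.
- by move=> n s; case: (tw n s).
- by move=> n s; case: (tw n s).
- move=> s t; have [v gv ev] := floer_eq fu (s0 + s) (t0 + t).
  apply: (@le_trans _ _ (phi (s0 + s) ^+ 2 * wsum h Y (coef v))).
    rewrite /wsum mulr_sumr; apply: ler_sum => n _; rewrite /sh.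
    by have [_ H] := Hgg n; rewrite (H _ _ _ gv ev) mulrCA.
  apply: ler_pM; first exact: sqr_ge0.
  + by apply: sumr_ge0 => n _; rewrite mulr_ge0 ?sqr_ge0// ltW// weight_gt0.
  + have := cutoff_k_le2 (s0 + s) cphi; rewrite -(real_normK (num_real (phi _))) => h2.
    by rewrite (_ : 4 = 2 ^+ 2 :> R) ?ler_sqr ?nnegrE//; ring.
  + exact: (gradient_bound Y h0 ext (HC _) gv).
- move=> n s sp; rewrite wE mulrAC ler_pM2r ?weight_gt0// -exprMn.
  rewrite ler_sqr ?nnegrE; last 2 first.
  + by rewrite mulr_ge0 ?powR_ge0 ?expR_ge0.
  + by rewrite mulr_ge0 ?decay_ge0// ltW.
  apply: le_trans (Hm _ _ (U01 n) sp); apply: ler_wpM2l; first exact: powR_ge0.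
  by rewrite ler_expR mulNr lerN2 ler_pM2r.
- move=> n s sp; rewrite wE mulrAC ler_pM2r ?weight_gt0// -exprMn.
  rewrite ler_sqr ?nnegrE; last 2 first.
  + by rewrite mulr_ge0 ?powR_ge0 ?expR_ge0.
  + by rewrite !mulr_ge0 ?decay_ge0 ?expR_ge0// ltW.
  apply: (@le_trans _ _ (U n `^ (1 + eta) * expR (- (ka * c * U n * s)) * expR (ka * s))).
    rewrite -mulrA -expRD; apply: ler_wpM2l; first exact: powR_ge0.
    rewrite ler_expR; have := ler_wpM2r (ltW sp) (mu_le n); lra.
  by apply: ler_wpM2r; [exact: expR_ge0|exact: Hm].
- move=> e e0; have [S HS] := floer_far fu e0; exists (S + `|s0|) => n s t Ss.
  have Ss' : S <= `|s0 + s|.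
    have := ler_normB (s0 + s) s0; rewrite addrAC subrr add0r; lra.
  split; first by apply: le_trans (Re_coef_le _ _) _; exact: HS.
  by apply: le_trans (Im_coef_le _ _) _; exact: HS.
Qed.

End FloerBound.

(** * Passage to the limits [k -> oo] and [s_n -> oo] *)

Theorem theorem4p4 (R : realType) (X T h : R) (d : nat)
  (F : R -> Hilb (0 : R) -> R)
  (phi : R -> R) (phik : nat -> R -> R)
  (uk : nat -> R^o * R^o -> Hilb (0 : R)) (sub : nat -> nat)
  (ut : R^o * R^o -> Hilb (0 : R))
  (sn : nat -> R) (u1 : R -> Hilb (0 : R)) :
  let r := irr_measure (freq X T d) in
  let N := (Num.truncn (h / d%:R)).-1 in
  A_admissible X T h d F ->
  cutoff phi ->
  (forall k, (1 <= k)%N -> cutoff_k k (phik k)) ->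
  (forall s : R, phik k s @[k --> \oo] --> phi s) ->
  (forall k, (1 <= k)%N -> floer_curve X T d F k (phik k) (uk k)) ->
  (1 <= sub 0)%N ->
  {homo sub : m n / (m < n)%N} ->
  C_loc_limit N (fun m => uk (sub m)) ut ->
  sn @ \oo --> +oo ->
  C_limit N (fun n t => ut (sn n, t)) u1 ->
  periodic_orbit X T d F u1 ->
  (forall p, coef (ut p) \in scale (h - d%:R * (r - 1) - 1 / 2)) /\
  (forall t, coef (flow X d t (u1 t)) \in scale (h - d%:R * (r - 1) - 1 / 2)).
Proof.
move=> r N adm _ cphi _ floer sub0 subm [_ lim] _ [_ lim1] _.
have [M HM] := floer_bound adm.
(* Monotonicity keeps the indices of the subsequence at least [1], where the Floer equation is
   given. *)
have sub1 m : (1 <= sub m)%N.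
  by case: m => // m; apply: leq_trans sub0 _; apply/ltnW/subm.
have ut_le p Y : wsum (h - d%:R * (r - 1) - 1 / 2) Y (coef (ut p)) <= M.
  apply: (@wsum_limit R _ Y _ (fun m => uk (sub m) p)).
    exact: family_compact_norm_le (fmap_filter _ _) (lim 0%N 0%N (leq0n _)) p.
  by move=> m; apply: HM; [exact: floer|exact: cphi].
split=> [p|t]; first exact: wsum_scale (ut_le p).
(* The flow multiplies each coefficient by a number of modulus at most [1], so it suffices to treat
   [u1]. *)
apply: scale_diag => [n|]; first exact: norm_expi.
apply: (@wsum_scale _ _ _ M) => Y.
apply: (@wsum_limit R _ Y _ (fun n => ut (sn n, t))) => [|n]; last exact: ut_le.
exact: family_compact_norm_le (fmap_filter _ _) (lim1 0%N (leq0n _)) t.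
Qed.
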